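(* Let $X$ be a Hausdorff topological space and $\mu$ a $\sigma$-finite Borel measure on $X$. Let $\mathcal E$ be a nonlinear order preserving form on $L^2(\mu)$ for which $\mathcal E_e$ exists; assume $\mathcal E$ is reflexive, subcritical and satisfies the $\Delta_2$-condition, and that there exists an $\mathcal E$-excessive function $h\in D(\mathcal E_e)$ with $h>0$ a.e. For $A\subseteq X$ the following are equivalent: (i) $A$ is $\mathcal E$-exceptional; (ii) for all $\mathcal E$-excessive $\tilde h\in D(\mathcal E_e)$ with $\tilde h>0$ a.e. we have $\mathrm{cap}_{\tilde h}(A)=0$. If moreover $Nh$ is $\mathcal E$-excessive for each $N\in\mathbb N$, then these are equivalent to (iii) $\mathrm{cap}_h(A)=0$.
   Context: $L^0(\mu)$ carries local convergence in measure. A nonlinear order preserving form is a lower semicontinuous convex $\mathcal E\colon L^2(\mu)\to[0,\infty]$ with $\mathcal E(-f)=\mathcal E(f)$, $\mathcal E(0)=0$ and $\mathcal E(f+|g|)+\mathcal E(f-|g|)\le\mathcal E(f+g)+\mathcal E(f-g)$. $M(\mathcal E)=\{f:\lim_{\lambda\to0+}\mathcal E(\lambda f)=0\}$, $\|f\|_L=\inf\{\lambda>0:\mathcal E(\lambda^{-1}f)\le1\}$; reflexive: image of $M(\mathcal E)$ dense in the bidual of $(M(\mathcal E),\|\cdot\|_L)$. $\Delta_2$-condition: $\mathcal E(2f)\le K\mathcal E(f)$ for some $K$ and all $f$. $\mathcal E_e$: lower semicontinuous relaxation on $L^0(\mu)$ (local convergence in measure) of $\mathcal E$ extended by $+\infty$;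 $M(\mathcal E_e)$, $\|\cdot\|_{L_e}$ its modular space and Luxemburg seminorm. Resolvent $G_\alpha f$ minimizes $g\mapsto\mathcal E(g)+\frac\alpha2\|g-\alpha^{-1}f\|_2^2$, extended to nonnegative functions by monotone limits; $Gf=\lim_{\alpha\to0+}G_\alpha f$; subcritical: $Gf<\infty$ a.e. for some measurable $f>0$. A measurable $\tilde h\ge0$ is $\mathcal E$-excessive if $G_\alpha(\alpha\tilde h)\le\tilde h$ for all $\alpha>0$; for such $\tilde h$, $\mathrm{cap}_{\tilde h}(A)=\inf\{\mathcal E_e(f): f\in L^0(\mu),\ f\ge\tilde h$ a.e. on an open neighborhood of $A\}$. For $G\subseteq X$ and $\mathcal F\subseteq L^0(\mu)$, $\mathcal F_G=\{f\in\mathcal F: f=0$ on an open neighborhood of $X\setminus G\}$. An increasing sequence $(F_n)$ of closed sets is an $\mathcal E$-nest if $\bigcup_nM(\mathcal E_e)_{F_n}$ is $\|\cdot\|_{L_e}$-dense in $M(\mathcal E_e)$. $A$ is $\mathcal E$-exceptional if there is an $\mathcal E$-nest $(F_n)$ with $A\subseteq\bigcap_n(X\setminus F_n)$. *)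

(* Defs.v *)
From HB Require Import structures.
From mathcomp Require Import all_boot all_order all_algebra.
From mathcomp Require Import all_classical all_reals all_analysis.
Set Implicit Arguments. Unset Strict Implicit. Unset Printing Implicit Defensive.
Import Order.TTheory GRing.Theory Num.Theory.
Import numFieldNormedType.Exports.
Local Open Scope classical_set_scope.
Local Open Scope ring_scope.

Notation borel X := (g_sigma_algebraType (@open X)).

Section NOPF.
Context (R : realType) (X : ptopologicalType)
        (mu : {measure set (borel X) -> \bar R}).

(* measurable real functions: representatives of elements of L^0(mu) *)
Definition L0 (f : X -> R) : Prop := measurable_fun [set: borel X] (f : borel X -> R).

Definition l2sq (f : X -> R) : \bar R := \int[mu]_x ((f x) ^+ 2)%:E.

Definition L2 (f : X -> R) : Prop := L0 f /\ (l2sq f < +oo)%E.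

Definition ae_eq (f g : X -> R) : Prop := {ae mu, forall x, f x = g x}.

(* Nonlinear order preserving form on L^2(mu); E is given on representatives,
   its values outside L^2 are irrelevant. *)
Definition nopf (E : (X -> R) -> \bar R) : Prop :=
  (forall f g, L2 f -> L2 g -> ae_eq f g -> E f = E g) /\
  (forall f, L2 f -> (0 <= E f)%E) /\
  (forall (fn : nat -> X -> R) f, (forall n, L2 (fn n)) -> L2 f ->
     (fun n => l2sq (fun x => fn n x - f x)) @ \oo --> 0%E ->
     (E f <= limn_einf (fun n => E (fn n)))%E) /\
  (forall f g (t : R), L2 f -> L2 g -> 0 <= t <= 1 ->
     (E (fun x => (t * f x + (1 - t) * g x)%R) <= t%:E * E f + (1 - t)%:E * E g)%E) /\
  (forall f, L2 f -> E (fun x => - f x) = E f) /\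
  E (fun _ => 0) = 0%E /\
  (forall f g, L2 f -> L2 g ->
     (E (fun x => (f x + `|g x|)%R) + E (fun x => (f x - `|g x|)%R)
       <= E (fun x => (f x + g x)%R) + E (fun x => (f x - g x)%R))%E).

Definition Eext (E : (X -> R) -> \bar R) (f : X -> R) : \bar R :=
  if `[< L2 f >] then E f else +oo%E.

Definition loc_cvg_meas (fn : nat -> X -> R) (f : X -> R) : Prop :=
  forall (B : set (borel X)) (eps : R), measurable B -> (mu B < +oo)%E -> 0 < eps ->
    (fun n => mu (B `&` [set x | eps < `|fn n x - f x|])) @ \oo --> 0%E.

(* E_e : lower semicontinuous relaxation on L^0 (with local convergence in
   measure, a metrizable topology) of E extended by +oo; given by the
   sequential formula valid in metrizable spaces. *)
Definition Ee (E : (X -> R) -> \bar R) (f : X -> R) : \bar R :=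
  ereal_inf [set limn_einf (fun n => Eext E (fn n)) |
             fn in [set fn : nat -> X -> R | (forall n, L0 (fn n)) /\ loc_cvg_meas fn f]].

Definition Ee_exists (E : (X -> R) -> \bar R) : Prop :=
  forall f, L2 f -> Ee E f = E f.

Definition dom_Ee (E : (X -> R) -> \bar R) (f : X -> R) : Prop :=
  L0 f /\ (Ee E f < +oo)%E.

Definition modular (F : (X -> R) -> \bar R) (dom : (X -> R) -> Prop) (f : X -> R) : Prop :=
  dom f /\ (fun l : R => F (fun x => l * f x)) @ 0^'+ --> 0%E.

Definition luxemburg (F : (X -> R) -> \bar R) (f : X -> R) : \bar R :=
  ereal_inf [set l%:E | l in [set l : R | 0 < l /\ (F (fun x => (l^-1 * f x)%R) <= 1)%E]].

Definition ME (E : (X -> R) -> \bar R) := modular E L2.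
Definition normL (E : (X -> R) -> \bar R) := luxemburg E.
Definition MEe (E : (X -> R) -> \bar R) := modular (Ee E) L0.
Definition normLe (E : (X -> R) -> \bar R) := luxemburg (Ee E).

Definition bounded_by (E : (X -> R) -> \bar R) (phi : (X -> R) -> R) (K : R) : Prop :=
  forall y, ME E y -> (`|phi y|%:E <= K%:E * normL E y)%E.

Definition in_dual (E : (X -> R) -> \bar R) (phi : (X -> R) -> R) : Prop :=
  (forall (a b : R) f g, ME E f -> ME E g ->
     phi (fun x => a * f x + b * g x) = (a * phi f + b * phi g)%R) /\
  exists K : R, (0 <= K)%R /\ bounded_by E phi K.

Definition in_bidual (E : (X -> R) -> \bar R) (Phi : ((X -> R) -> R) -> R) : Prop :=
  (forall (a b : R) phi psi, in_dual E phi -> in_dual E psi ->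
     Phi (fun y => a * phi y + b * psi y) = (a * Phi phi + b * Phi psi)%R) /\
  exists C : R, (0 <= C)%R /\
    forall phi (K : R), in_dual E phi -> (0 <= K)%R -> bounded_by E phi K ->
      (`|Phi phi| <= C * K)%R.

(* reflexive: the canonical image of M(E) is dense in the bidual (w.r.t. the
   bidual norm: ||Phi - j f|| <= eps) *)
Definition reflexive_form (E : (X -> R) -> \bar R) : Prop :=
  forall Phi (eps : R), in_bidual E Phi -> (0 < eps)%R ->
    exists f, ME E f /\
      forall phi (K : R), in_dual E phi -> (0 <= K)%R -> bounded_by E phi K ->
        (`|Phi phi - phi f| <= eps * K)%R.

Definition Delta2 (E : (X -> R) -> \bar R) : Prop :=
  exists K : R, forall f, L2 f -> (E (fun x => (2 * f x)%R) <= K%:E * E f)%E.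

Definition resolvent (E : (X -> R) -> \bar R) (alpha : R) (f g : X -> R) : Prop :=
  L2 g /\ forall k, L2 k ->
    (E g + (alpha / 2)%:E * l2sq (fun x => (g x - alpha^-1 * f x)%R)
      <= E k + (alpha / 2)%:E * l2sq (fun x => (k x - alpha^-1 * f x)%R))%E.

Definition resolvent_ext (E : (X -> R) -> \bar R) (alpha : R) (f : X -> R)
    (u : X -> \bar R) : Prop :=
  exists (fn gn : nat -> X -> R),
    (forall n, L2 (fn n)) /\
    (forall n, resolvent E alpha (fn n) (gn n)) /\
    {ae mu, forall x, (forall n, (0 <= fn n x)%R /\ (fn n x <= fn n.+1 x)%R) /\
                      (fun n => fn n x) @ \oo --> (f x)} /\
    {ae mu, forall x, (fun n => (gn n x)%:E) @ \oo --> (u x)}.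

(* subcritical: G f < oo a.e. for some measurable f > 0, with
   G f = lim_{alpha -> 0+} G_alpha f *)
Definition subcritical (E : (X -> R) -> \bar R) : Prop :=
  exists (f : X -> R) (u : R -> X -> \bar R),
    L0 f /\ (forall x, (0 < f x)%R) /\
    (forall alpha, (0 < alpha)%R -> resolvent_ext E alpha f (u alpha)) /\
    {ae mu, forall x, exists l : \bar R,
        (fun alpha => u alpha x) @ 0^'+ --> l /\ (l < +oo)%E}.

Definition excessive (E : (X -> R) -> \bar R) (h : X -> R) : Prop :=
  L0 h /\ (forall x, (0 <= h x)%R) /\
  forall (alpha : R) (u : X -> \bar R), (0 < alpha)%R ->
    resolvent_ext E alpha (fun x => alpha * h x) u ->
    {ae mu, forall x, (u x <= (h x)%:E)%E}.

Definition cap (E : (X -> R) -> \bar R) (h : X -> R) (A : set X) : \bar R :=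
  ereal_inf [set Ee E f | f in [set f : X -> R | L0 f /\
     exists U : set X, open U /\ A `<=` U /\ {ae mu, forall x, U x -> (h x <= f x)%R}]].

Definition MEe_on (E : (X -> R) -> \bar R) (F : set X) (f : X -> R) : Prop :=
  MEe E f /\ exists U : set X, open U /\ ~` F `<=` U /\ {ae mu, forall x, U x -> f x = 0%R}.

Definition nest (E : (X -> R) -> \bar R) (F : nat -> set X) : Prop :=
  (forall n, closed (F n)) /\ (forall n, F n `<=` F n.+1) /\
  forall f (eps : R), MEe E f -> (0 < eps)%R ->
    exists n g, MEe_on E (F n) g /\ (normLe E (fun x => (f x - g x)%R) < eps%:E)%E.

Definition exceptional (E : (X -> R) -> \bar R) (A : set X) : Prop :=
  exists F : nat -> set X, nest E F /\ A `<=` \bigcap_n (~` F n).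

End NOPF.

(* Main.v *)
(** The relaxation [Ee] is convex, even, lower semicontinuous along a.e. convergent
    sequences, and submodular: Ee (u /\ v) + Ee (u \/ v) <= Ee u + Ee v.

    If A is exceptional and [ht] lies in D(Ee), approximate [ht] in norm by some g
    vanishing near A; then ht - g competes in the capacity and has small energy.

    Conversely, suppose there are functions e_N >= 0 increasing to infinity such that
    truncation by e_N does not increase [Ee] and cap_{e_N}(A) = 0.  Choose p_N >= e_N on
    a neighbourhood U_N of A with Ee (2^N p_N) <= 1.  For f in D(E), clip f to
    [-e_N, e_N] and shrink it towards 0 by p_N: the result z_N vanishes on U_N, is bounded
    in energy, and z_N -> f a.e., because subcriticality forces p_N -> 0 a.e.  By
    reflexivity, convex combinations of the z_N converge to f in norm (a Mazur lemma: the
    ultrafilter limit of the z_N in the bidual is norm-close to M(E), and Hahn-Banach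
    brings the convex hull close to it).  Hence the complements of the finite
    intersections of the U_N form a nest.

    In case (iii) one takes e_N = N h: truncation by an excessive function decreases the
    energy, as seen by comparing f with the resolvents of f /\ e.  In case (ii) e_N is
    the minimizer of [Ee] above the obstacle N h; it exists since subcriticality keeps the
    increasing tail infima of a minimizing sequence finite, and minimality makes it
    excessive. *)
Require Import Defs.
From HB Require Import structures.
From mathcomp Require Import all_boot all_order all_algebra.
From mathcomp Require Import all_classical all_reals all_analysis measurable_realfun ring lra.
Import Order.TTheory GRing.Theory Num.Theory.
Import numFieldNormedType.Exports.
Local Open Scope classical_set_scope.
Local Open Scope ring_scope.
Set Implicit Arguments. Unset Strict Implicit. Unset Printing Implicit Defensive.

(** * Almost everywhere convergence *)
Section MeasureTools.
Context (d : measure_display) (T : measurableType d) (R : realType)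
        (mu : {measure set T -> \bar R}).

(** The relaxation is defined through local convergence in measure, while lattice operations and
    Fatou work pointwise. Sigma-finiteness bridges the two: a diagonal choice along an exhaustion by
    sets of finite measure, with errors [2^-k], yields almost everywhere convergence. Energies are
    carried as bounds by real constants, which avoids subtracting extended reals.

    Excessivity quantifies over extended resolvents and yields nothing until some are constructed;
    this is why existence and monotonicity of proximal minimizers come early. Subcriticality enters
    through one weighted estimate: for some [f > 0] and a finite [l], the integral of
    [f * (k - l)^+] is at most the energy of [k].

    Delta2 identifies each modular space with its energy domain, so that energy bounds and norm
    bounds can be exchanged. Reflexivity concerns only the L2 modular space, and only density in the
    bidual. The Mazur lemma therefore never identifies the bidual limit with [f], and it is also
    what reaches elements of [M(Ee)] outside L2. *)

Lemma aeS (P Q : T -> Prop) : (forall x, P x -> Q x) ->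
  {ae mu, forall x, P x} -> {ae mu, forall x, Q x}.
Proof. by move=> PQ; apply: filterS. Qed.

Lemma aeS2 (P P' Q : T -> Prop) : (forall x, P x -> P' x -> Q x) ->
  {ae mu, forall x, P x} -> {ae mu, forall x, P' x} -> {ae mu, forall x, Q x}.
Proof. by move=> PQ; apply: filterS2. Qed.

Lemma aeS3 (P P' P'' Q : T -> Prop) : (forall x, P x -> P' x -> P'' x -> Q x) ->
  {ae mu, forall x, P x} -> {ae mu, forall x, P' x} -> {ae mu, forall x, P'' x} ->
  {ae mu, forall x, Q x}.
Proof. by move=> PQ; apply: filterS3. Qed.

Lemma limn_einf_ge (u : nat -> \bar R) (N : nat) (c : \bar R) :
  (forall n, (N <= n)%N -> (c <= u n)%E) -> (c <= limn_einf u)%E.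
Proof.
move=> H; rewrite limn_einf_lim.
apply: lime_ge; first exact: is_cvg_einfs.
near=> n; apply: le_ereal_inf_tmp => _ [m /= nm <-]; apply: H.
by apply: leq_trans nm; near: n; exact: nbhs_infty_ge.
Unshelve. all: by end_near. Qed.

Lemma limn_einf_le (u : nat -> \bar R) (c : \bar R) :
  (forall N, exists n, (N <= n)%N /\ (u n <= c)%E) -> (limn_einf u <= c)%E.
Proof.
move=> H; rewrite limn_einf_lim.
apply: lime_le; first exact: is_cvg_einfs.
apply: nearW => n; have [m [nm um]] := H n.
by apply: le_trans um; apply: ereal_inf_lbound; exists m.
Qed.

Lemma limn_einf_lt_freq (u : nat -> \bar R) (c : \bar R) :
  (limn_einf u < c)%E -> forall N, exists n, (N <= n)%N /\ (u n < c)%E.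
Proof.
move=> H N; apply: contrapT => /forallNP H1.
move: H; apply/negP; rewrite -leNgt; apply: (@limn_einf_ge _ N) => n Nn.
by rewrite leNgt; apply/negP => un; apply: (H1 n).
Qed.

Lemma cvgn_max (a b : nat -> R) (la lb : R) :
  a n @[n --> \oo] --> la -> b n @[n --> \oo] --> lb ->
  Num.max (a n) (b n) @[n --> \oo] --> Num.max la lb.
Proof.
move=> ca cb; rewrite maxr_absE.
have -> : (fun n => Num.max (a n) (b n)) = (fun n => (a n + b n + `|a n - b n|) / 2).
  by apply/funext => n; rewrite maxr_absE.
apply: cvgM; last exact: cvg_cst.
by apply: cvgD; [exact: cvgD|apply: cvg_norm; exact: cvgB].
Qed.

Lemma cvgn_min (a b : nat -> R) (la lb : R) :
  a n @[n --> \oo] --> la -> b n @[n --> \oo] --> lb ->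
  Num.min (a n) (b n) @[n --> \oo] --> Num.min la lb.
Proof.
move=> ca cb; rewrite minr_absE.
have -> : (fun n => Num.min (a n) (b n)) = (fun n => (a n + b n - `|a n - b n|) / 2).
  by apply/funext => n; rewrite minr_absE.
apply: cvgM; last exact: cvg_cst.
by apply: cvgB; [exact: cvgD|apply: cvg_norm; exact: cvgB].
Qed.

Lemma cvgn_geometric_increments (a : nat -> R) (N : nat) :
  (forall n, (N <= n)%N -> `|a n.+1 - a n| <= 2^-1 ^+ n) -> cvgn a.
Proof.
move=> H; pose b n := a (n + N)%N.
suff /cvg_ex[l cb] : cvgn b by apply/cvg_ex; exists l; move: cb; rewrite /b (cvg_shiftn N a).
have -> : b = (fun n => b 0%N + series (telescope b) n).
  by apply/funext => n; rewrite [LHS]eq_sum_telescope.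
apply: is_cvgD; first exact: is_cvg_cst.
apply: normed_cvg; apply: (@series_le_cvg _ _ (geometric 1 2^-1)) => [n|n|n|].
- exact: normr_ge0.
- by rewrite /geometric/= mul1r exprn_ge0.
- rewrite /geometric /telescope /= mul1r /b addSn.
  apply: le_trans (H _ (leq_addl _ _)) _; rewrite exprD ger_pMr ?exprn_gt0//.
  by rewrite exprn_ile1// invf_le1// ler1n.
- by apply: is_cvg_geometric_series; rewrite ger0_norm// invf_lt1// ltr1n.
Qed.

Lemma measurable_gt_fun (f : T -> R) (c : R) :
  measurable_fun setT f -> measurable [set x | c < f x].
Proof.
move=> mf; rewrite -[X in measurable X]setTI.
have -> : [set x | c < f x] = f @^-1` `]c, +oo[%classic.
  by apply/seteqP; split => x /=; rewrite in_itv /= andbT.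
exact: mf.
Qed.

Lemma measurable_fun_limn_einf (f : nat -> T -> \bar R) :
  (forall n, measurable_fun setT (f n)) ->
  measurable_fun setT (fun x => limn_einf (f ^~ x)).
Proof.
move=> mf; rewrite /limn_einf; apply: measurableT_comp => //.
apply: measurable_fun_limn_esup => n.
exact: measurableT_comp.
Qed.

Lemma cvgn_fine_limn_einf (b : nat -> R) : cvgn b ->
  b n @[n --> \oo] --> fine (limn_einf (fun n => (b n)%:E)).
Proof.
move=> /cvg_ex[l cl].
have /cvg_limn_einf_sup[-> _] : (b n)%:E @[n --> \oo] --> l%:E; last by [].
by apply/cvg_EFin => //; apply: nearW.
Qed.

(** A bound along infinitely many indices already controls the liminf of the integrals. *)
Lemma fatou_ae (phi : nat -> T -> R) (phi0 : T -> R) (c : \bar R) :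
  (forall n, measurable_fun setT (phi n)) -> measurable_fun setT phi0 ->
  (forall n x, 0 <= phi n x) -> (forall x, 0 <= phi0 x) ->
  {ae mu, forall x, phi n x @[n --> \oo] --> phi0 x} ->
  (forall N, exists n, (N <= n)%N /\ (\int[mu]_x (phi n x)%:E <= c)%E) ->
  (\int[mu]_x (phi0 x)%:E <= c)%E.
Proof.
move=> mphi mphi0 phi_ge0 phi0_ge0 cv H.
have mE n : measurable_fun setT (EFin \o phi n) by apply/measurable_EFinP.
have me : measurable_fun setT (fun x => limn_einf (fun n => (EFin \o phi n) x)).
  exact: measurable_fun_limn_einf.
apply: le_trans (limn_einf_le H).
have f0 n x : [set: T] x -> (0 <= (EFin \o phi n) x)%E by rewrite lee_fin.
apply: le_trans (fatou mu measurableT mE f0).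
apply: ae_ge0_le_integral => //.
- by move=> x _; rewrite lee_fin.
- exact/measurable_EFinP.
- by move=> x _; apply: (@limn_einf_ge _ 0%N) => n _; rewrite lee_fin.
- apply: filterS cv => x cvx _.
  have /cvg_limn_einf_sup[-> _] // : (phi n x)%:E @[n --> \oo] --> (phi0 x)%:E.
  by apply/cvg_EFin => //; near=> n.
Unshelve. all: by end_near. Qed.

Lemma nneseries_geometric_lty (C : R) : 0 <= C ->
  (\sum_(0 <= n <oo) (C * 2^-1 ^+ n)%:E < +oo)%E.
Proof.
move=> C0; apply: (@le_lt_trans _ _ (C * (1 - 2^-1)^-1)%:E); last exact: ltry.
apply: lime_le; first by apply: is_cvg_nneseries => n _ _; rewrite lee_fin mulr_ge0// exprn_ge0.
apply: nearW => n; rewrite sumEFin lee_fin.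
by apply: (geometric_le_lim n) => //; rewrite ger0_norm// invf_lt1// ltr1n.
Qed.

(** The sum of the [phi n] has finite integral, so it is finite almost everywhere and its terms tend
    to 0. This replaces the extraction of subsequences from convergence in norm. *)
Lemma ae_cvg0_summable (phi : nat -> T -> R) (C : R) :
  (forall n, measurable_fun setT (phi n)) -> (forall n x, 0 <= phi n x) ->
  (forall n, (\int[mu]_x (phi n x)%:E <= (C * 2^-1 ^+ n)%:E)%E) ->
  {ae mu, forall x, phi n x @[n --> \oo] --> (0 : R)}.
Proof.
move=> mphi phi_ge0 H.
have mE n : measurable_fun setT (EFin \o phi n) by apply/measurable_EFinP.
have phi0 n x : [set: T] x -> (0 <= (phi n x)%:E)%E by rewrite lee_fin.
have C0 : 0 <= C.
  have := H 0%N; rewrite expr0 mulr1 => h.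
  by rewrite -lee_fin; apply: le_trans h; apply: integral_ge0 => x _; rewrite lee_fin.
have fin : (\int[mu]_x (\sum_(0 <= n <oo) (phi n x)%:E) < +oo)%E.
  rewrite integral_nneseries//.
  apply: (@le_lt_trans _ _ (\sum_(0 <= n <oo) (C * 2^-1 ^+ n)%:E)%E).
    by apply: lee_nneseries => // n _ _; apply: integral_ge0 => x _; rewrite lee_fin.
  exact: nneseries_geometric_lty.
have : {ae mu, forall x, ((\sum_(0 <= n <oo) (phi n x)%:E) < +oo)%E}.
  have mS : measurable_fun setT (fun x => (\sum_(0 <= n <oo) (phi n x)%:E)%E).
    apply: (@ge0_emeasurable_sum _ _ _ setT (fun n => EFin \o phi n) xpredT).
      by move=> k x _ _; exact: phi0.
    by move=> k _; exact: mE.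
  have iS : mu.-integrable setT (fun x => (\sum_(0 <= n <oo) (phi n x)%:E)%E).
    apply/integrableP; split => //.
    rewrite (eq_integral (fun x => \sum_(0 <= n <oo) (phi n x)%:E)%E)// => x _.
    by rewrite gee0_abs//; apply: nneseries_ge0 => n _ _; exact: phi0.
  have := integrable_ae measurableT iS.
  by apply: filterS => x /(_ I); rewrite fin_numE => /andP[_]; rewrite lt_neqAle leey andbT.
apply: filterS => x Sx.
apply: cvg_series_cvg_0.
set S := (\sum_(0 <= n <oo) (phi n x)%:E)%E in Sx.
have S0 : (0 <= S)%E by apply: nneseries_ge0 => n _ _; exact: phi0.
have Sfin : S \is a fin_num by rewrite ge0_fin_numE.
apply: (nondecreasing_is_cvgn (u_ := series (phi ^~ x))).
  by apply: nondecreasing_series.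
exists (fine S) => _ [n _ <-].
rewrite -lee_fin fineK// /series/= -sumEFin.
by apply: nneseries_lim_ge => k _ _; exact: phi0.
Unshelve. all: by end_near. Qed.

(** Borel-Cantelli: the deviation sets [B k] have summable measure. A point outside their limsup
    eventually lies in [F k] but not in [B k], so the difference there is at most [2^-k]. *)
Lemma ae_cvg0_fast (F : nat -> set T) (u v : nat -> T -> R) :
  {homo F : n m / (n <= m)%N >-> (n <= m)%O} -> \bigcup_i F i = setT ->
  (forall n, measurable (F n)) ->
  (forall n, measurable_fun setT (u n)) -> (forall n, measurable_fun setT (v n)) ->
  (forall k, (mu (F k `&` [set x | ((2^-1 ^+ k) < `|u k x - v k x|)%R]) <= (2^-1 ^+ k)%:E)%E) ->
  {ae mu, forall x, (u n x - v n x) @[n --> \oo] --> (0 : R)}.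
Proof.
move=> ndF cov mF mu_ mv H.
pose B k := F k `&` [set x | (2^-1 ^+ k) < `|u k x - v k x|].
have mB k : measurable (B k).
  apply: measurableI => //; apply: measurable_gt_fun.
  by apply: measurableT_comp => //; apply: measurable_funB.
have fin : (\sum_(n <oo) mu (B n) < +oo)%E.
  apply: (@le_lt_trans _ _ (\sum_(0 <= n <oo) (1 * 2^-1 ^+ n)%:E)%E).
    by apply: lee_nneseries => // n _; rewrite mul1r; exact: H.
  exact: nneseries_geometric_lty.
exists (lim_sup_set B); split.
- by apply: bigcap_measurable => // n _; apply: bigcup_measurable => k _; exact: mB.
- exact: lim_sup_set_cvg0.
move=> x /= ncv; apply: contrapT => nB; apply: ncv.
have [N HN] : exists N, forall j, (N <= j)%N -> ~ B j x.
  apply: contrapT => /forallNP h; apply: nB => N _.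
  apply: contrapT => h2; apply: (h N) => j Nj Bj; apply: h2; exists j => //.
have [i _ Fi] : (\bigcup_i F i) x by rewrite cov.
apply/norm_cvg0P.
apply: (@squeeze_cvgr _ _ _ _ (cst 0) (fun n => 2^-1 ^+ n)).
- near=> n; rewrite normr_ge0 /= leNgt; apply/negP => lt.
  apply: (HN n); first by near: n; exact: nbhs_infty_ge.
  split => //; have : (F i <= F n)%O by apply: ndF; near: n; exact: nbhs_infty_ge.
  by rewrite subsetEset => /(_ x Fi).
- exact: cvg_cst.
- by apply: cvg_expr; rewrite ger0_norm ?invr_ge0// invf_lt1// ltr1n.
Unshelve. all: by end_near. Qed.

Lemma ae_cvg_in_measure (fn : nat -> T -> R) (f : T -> R) (B : set T) (eps : R) :
  (forall n, measurable_fun setT (fn n)) -> measurable_fun setT f ->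
  {ae mu, forall x, fn n x @[n --> \oo] --> f x} ->
  measurable B -> (mu B < +oo)%E -> 0 < eps ->
  (fun n => mu (B `&` [set x | eps < `|fn n x - f x|])) @ \oo --> 0%E.
Proof.
move=> mfn mf cv mB Bfin e0.
pose C n := B `&` [set x | eps < `|fn n x - f x|].
have mC n : measurable (C n).
  apply: measurableI => //; apply: measurable_gt_fun.
  by apply: measurableT_comp => //; apply: measurable_funB.
have iB : mu.-integrable setT (fun x => (\1_B x)%:E).
  apply/integrableP; split; first by apply/measurable_EFinP; exact: measurable_indic.
  under eq_integral do rewrite gee0_abs ?lee_fin//.
  by rewrite integral_indic// setIT.
have [||||_ _] := dominated_convergence (mu := mu) (f_ := fun n x => (\1_(C n) x)%:E)
  (f := cst 0%E) measurableT _ _ _ iB.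
- move=> n; apply/measurable_EFinP; exact: measurable_indic.
- exact: measurable_cst.
- apply: filterS cv => x cvx _.
  apply: cvg_near_cst; near=> n; rewrite indicE memNset// => -[_ /=].
  apply/negP; rewrite -leNgt distrC; near: n.
  have /cvgrPdist_le := cvx; exact.
- apply: aeW => x n _; rewrite gee0_abs ?lee_fin// !indicE.
  have [/set_mem[Bx _]|] := boolP (x \in C n); first by rewrite mem_set.
  by [].
rewrite integral0 => h; apply: cvg_trans h; apply: near_eq_cvg; near=> n.
by rewrite /= integral_indic ?setIT.
Unshelve. all: by end_near. Qed.

End MeasureTools.

(** * The relaxed form *)
Section Form.
Context (R : realType) (X : ptopologicalType)
        (mu : {measure set (borel X) -> \bar R}).
Implicit Types f g u v w : X -> R.

(** * Measurable and square integrable functions *)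

Lemma L0D f g : L0 f -> L0 g -> L0 (fun x => f x + g x).
Proof. exact: measurable_funD. Qed.
Lemma L0B f g : L0 f -> L0 g -> L0 (fun x => f x - g x).
Proof. exact: measurable_funB. Qed.
Lemma L0N f : L0 f -> L0 (fun x => - f x).
Proof. by move=> mf; apply: measurableT_comp. Qed.
Lemma L0cst (a : R) : L0 (fun _ : X => a).
Proof. exact: measurable_cst. Qed.
Lemma L0M f g : L0 f -> L0 g -> L0 (fun x => f x * g x).
Proof. exact: measurable_funM. Qed.
Lemma L0Z (a : R) f : L0 f -> L0 (fun x => a * f x).
Proof. by move=> mf; apply: L0M => //; exact: L0cst. Qed.
Lemma L0X f n : L0 f -> L0 (fun x => f x ^+ n).
Proof. by move=> mf; exact: measurable_funX. Qed.
Lemma L0abs f : L0 f -> L0 (fun x => `|f x|).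
Proof. by move=> mf; apply: measurableT_comp. Qed.
Lemma L0max f g : L0 f -> L0 g -> L0 (fun x => Num.max (f x) (g x)).
Proof. exact: measurable_maxr. Qed.
Lemma L0min f g : L0 f -> L0 g -> L0 (fun x => Num.min (f x) (g x)).
Proof. exact: measurable_minr. Qed.

(** The comparisons of squared norms below are brought to this subtraction-free form, which for
    nonnegative integrands needs no integrability. *)
Lemma integral_le4 (a b c e : R) (p q r s : X -> R) :
  0 <= a -> 0 <= b -> 0 <= c -> 0 <= e ->
  L0 p -> L0 q -> L0 r -> L0 s ->
  (forall x, 0 <= p x) -> (forall x, 0 <= q x) ->
  (forall x, 0 <= r x) -> (forall x, 0 <= s x) ->
  {ae mu, forall x, a * p x + b * q x <= c * r x + e * s x} ->
  (a%:E * \int[mu]_x (p x)%:E + b%:E * \int[mu]_x (q x)%:E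
    <= c%:E * \int[mu]_x (r x)%:E + e%:E * \int[mu]_x (s x)%:E)%E.
Proof.
move=> a0 b0 c0 e0 mp mq mr ms p0 q0 r0 s0 H.
have int2 (a1 b1 : R) (p1 q1 : X -> R) : 0 <= a1 -> 0 <= b1 -> L0 p1 -> L0 q1 ->
    (forall x, 0 <= p1 x) -> (forall x, 0 <= q1 x) ->
    (a1%:E * \int[mu]_x (p1 x)%:E + b1%:E * \int[mu]_x (q1 x)%:E =
     \int[mu]_x (a1 * p1 x + b1 * q1 x)%:E)%E.
  move=> a10 b10 mp1 mq1 p10 q10.
  have mZ (t : R) (f : X -> R) : L0 f ->
      measurable_fun [set: borel X] (fun x => (t * f x)%:E : \bar R).
    by move=> mf; apply/measurable_EFinP; exact: L0Z.
  have mE (f : X -> R) : L0 f -> measurable_fun [set: borel X] (fun x => (f x)%:E : \bar R).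
    by move=> mf; apply/measurable_EFinP.
  under [RHS]eq_integral do rewrite EFinD.
  rewrite ge0_integralD//.
  - congr (_ + _)%E.
      under [RHS]eq_integral do rewrite EFinM.
      by rewrite ge0_integralZl//; [exact: mE|move=> x _; rewrite lee_fin].
    under [RHS]eq_integral do rewrite EFinM.
    by rewrite ge0_integralZl//; [exact: mE|move=> x _; rewrite lee_fin].
  - by move=> x _; rewrite lee_fin mulr_ge0.
  - exact: mZ.
  - by move=> x _; rewrite lee_fin mulr_ge0.
  - exact: mZ.
rewrite !int2//; apply: ae_ge0_le_integral => //.
- by move=> x _; rewrite lee_fin addr_ge0// mulr_ge0.
- by apply/measurable_EFinP; apply: L0D; exact: L0Z.
- by move=> x _; rewrite lee_fin addr_ge0// mulr_ge0.
- by apply/measurable_EFinP; apply: L0D; exact: L0Z.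
- by apply: aeS H => x Hx _; rewrite lee_fin.
Qed.

Lemma l2sq_ge0 f : (0 <= l2sq mu f)%E.
Proof. by apply: integral_ge0 => x _; rewrite lee_fin sqr_ge0. Qed.

Lemma L2_fin f : L2 mu f -> l2sq mu f = (fine (l2sq mu f))%:E.
Proof. by move=> [_ h]; rewrite fineK// ge0_fin_numE// l2sq_ge0. Qed.

Lemma L2_le3 (a b : R) f g k : L0 f -> L2 mu g -> L2 mu k -> 0 <= a -> 0 <= b ->
  (forall x, f x ^+ 2 <= a * g x ^+ 2 + b * k x ^+ 2) -> L2 mu f.
Proof.
move=> mf Lg Lk a0 b0 H; split => //.
have [mg _] := Lg; have [mk _] := Lk.
have := @integral_le4 1 0 a b (fun x => f x ^+ 2) (fun=> 0) (fun x => g x ^+ 2)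
  (fun x => k x ^+ 2) ler01 (lexx _) a0 b0 (L0X 2 mf) (L0cst 0) (L0X 2 mg) (L0X 2 mk).
rewrite mul1e mul0e adde0 => h.
apply: le_lt_trans (h _ _ _ _ _) _.
- by move=> x; rewrite sqr_ge0.
- by [].
- by move=> x; rewrite sqr_ge0.
- by move=> x; rewrite sqr_ge0.
- by apply: aeW => x; rewrite mul1r mul0r addr0.
by rewrite -!/(l2sq mu _) (L2_fin Lg) (L2_fin Lk) -!EFinM -EFinD ltry.
Qed.

Lemma L2_0 : L2 mu (fun _ : X => 0 : R).
Proof.
split; first exact: L0cst.
by rewrite /l2sq; under eq_integral do rewrite expr0n; rewrite integral0 ltry.
Qed.

Lemma L2_dom f g : L0 f -> L2 mu g -> (forall x, `|f x| <= `|g x|) -> L2 mu f.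
Proof.
move=> mf Lg H; apply: (@L2_le3 1 0 f g g) => // x.
rewrite mul1r mul0r addr0 -[f x ^+ 2]real_normK ?num_real// -[g x ^+ 2]real_normK ?num_real//.
by rewrite lerXn2r ?nnegrE.
Qed.

Lemma L2lin (a b : R) f g : L2 mu f -> L2 mu g -> L2 mu (fun x => a * f x + b * g x).
Proof.
move=> Lf Lg; have [mf _] := Lf; have [mg _] := Lg.
apply: (@L2_le3 (2 * a ^+ 2) (2 * b ^+ 2) _ f g) => //.
- by apply: L0D; exact: L0Z.
- by rewrite mulr_ge0// sqr_ge0.
- by rewrite mulr_ge0// sqr_ge0.
- move=> x; have : 0 <= (a * f x - b * g x) ^+ 2 by exact: sqr_ge0.
  by nra.
Qed.

Lemma L2D f g : L2 mu f -> L2 mu g -> L2 mu (fun x => f x + g x).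
Proof.
move=> Lf Lg; have := L2lin 1 1 Lf Lg.
by under eq_fun do rewrite !mul1r.
Qed.

Lemma L2Z (a : R) f : L2 mu f -> L2 mu (fun x => a * f x).
Proof.
move=> Lf; have := L2lin a 0 Lf Lf.
by under eq_fun do rewrite mul0r addr0.
Qed.

Lemma L2B f g : L2 mu f -> L2 mu g -> L2 mu (fun x => f x - g x).
Proof.
move=> Lf Lg; have := L2lin 1 (-1) Lf Lg.
by under eq_fun do rewrite mul1r mulN1r.
Qed.

Lemma L2max f g : L2 mu f -> L2 mu g -> L2 mu (fun x => Num.max (f x) (g x)).
Proof.
move=> Lf Lg; apply: (@L2_le3 1 1 _ f g) => //.
  by apply: L0max; [case: Lf|case: Lg].
by move=> x; rewrite !mul1r; case: (leP (f x) (g x)) => _; rewrite ?lerDl ?lerDr sqr_ge0.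
Qed.

Lemma L2min f g : L2 mu f -> L2 mu g -> L2 mu (fun x => Num.min (f x) (g x)).
Proof.
move=> Lf Lg; apply: (@L2_le3 1 1 _ f g) => //.
  by apply: L0min; [case: Lf|case: Lg].
by move=> x; rewrite !mul1r; case: (leP (f x) (g x)) => _; rewrite ?lerDl ?lerDr sqr_ge0.
Qed.

Lemma L2min_nneg f (e : X -> R) : L2 mu f -> L0 e -> (forall x, 0 <= e x) ->
  L2 mu (fun x => Num.min (f x) (e x)).
Proof.
move=> Lf me e0; apply: (L2_dom (g := f)) => //.
  by apply: L0min => //; case: Lf.
move=> x; have := e0 x; case: (leP (f x) (e x)) => // h ex.
by rewrite !ger0_norm //; lra.
Qed.

(** * Properties of the form and of its relaxation *)

Context (E : (X -> R) -> \bar R).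
Hypothesis (sf : sigma_finite [set: borel X] mu).
Hypothesis (nE : nopf mu E) (eE : Ee_exists mu E).

Lemma E_ge0 f : L2 mu f -> (0 <= E f)%E.
Proof. by case: nE => _ [h _]; exact: h. Qed.

(** For [f] the half-sum and [g] the half-difference, [f + |g|] and [f - |g|] are the maximum and
    the minimum, while [f + g] and [f - g] are [u] and [v]. *)
Lemma E_submod u v : L2 mu u -> L2 mu v ->
  (E (fun x => Num.max (u x) (v x)) + E (fun x => Num.min (u x) (v x)) <= E u + E v)%E.
Proof.
move=> Lu Lv; case: nE => _ [_ [_ [_ [_ [_ H]]]]].
have := H (fun x => 2^-1 * u x + 2^-1 * v x) (fun x => 2^-1 * u x + (- 2^-1) * v x)
  (L2lin _ _ Lu Lv) (L2lin _ _ Lu Lv).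
congr (_ + _ <= _ + _)%E; congr E; apply/funext => x.
- have -> : 2^-1 * u x + - 2^-1 * v x = 2^-1 * (u x - v x) by lra.
  by rewrite maxr_absE normrM ger0_norm//; lra.
- have -> : 2^-1 * u x + - 2^-1 * v x = 2^-1 * (u x - v x) by lra.
  by rewrite minr_absE normrM ger0_norm//; lra.
- by lra.
- by lra.
Qed.

Lemma ereal_cvg0_small (a : nat -> \bar R) (e : R) : a @ \oo --> 0%E -> 0 < e ->
  exists N, forall n, (N <= n)%N -> (a n <= e%:E)%E.
Proof.
move=> /fine_cvgP[fa /cvgrPdist_le/(_ e)] ca e0.
have [N1 _ H1] := fa; have [N2 _ H2] := ca e0.
exists (maxn N1 N2) => n; rewrite geq_max => /andP[n1 n2].
have := H2 n n2; rewrite /= sub0r normrN => h.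
by rewrite -(fineK (H1 n n1)) lee_fin; apply: le_trans (ler_norm _) h.
Qed.

Lemma cvg_of_diff (a b : nat -> R) (l : R) :
  a n - b n @[n --> \oo] --> (0 : R) -> b n @[n --> \oo] --> l -> a n @[n --> \oo] --> l.
Proof.
move=> h1 h2; have -> : a = (fun n => (a n - b n) + b n).
  by apply/funext => n; rewrite subrK.
by rewrite -[l]add0r; exact: cvgD h1 h2.
Qed.

(** At stage [k] an index is taken whose deviation from [f] exceeds [2^-k] only on measure at most
    [2^-k] of the [k]-th set of the exhaustion. The strict bound guarantees infinitely many indices
    of low energy, and these lie in L2 because [Eext] is infinite elsewhere. *)
Lemma Ee_lt f (c : R) : L0 f -> (Ee mu E f < c%:E)%E ->
  exists fn : nat -> X -> R, [/\ (forall n, L2 mu (fn n)), (forall n, (E (fn n) <= c%:E)%E) &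
    {ae mu, forall x, fn n x @[n --> \oo] --> f x}].
Proof.
move=> mf /ereal_inf_lt[_ [fn /= [mfn cf] <-]] /limn_einf_lt_freq H.
have [F [covF ndF HF]] := (sigma_finiteP _ _).1 sf.
have pw k : 0 < (2^-1 : R) ^+ k by rewrite exprn_gt0.
have Hk k : exists n, (Eext mu E (fn n) < c%:E)%E /\
    (mu (F k `&` [set x | (2^-1 ^+ k < `|fn n x - f x|)%R]) <= (2^-1 ^+ k)%:E)%E.
  have [N HN] := ereal_cvg0_small (cf (F k) _ (HF k).1 (HF k).2 (pw k)) (pw k).
  by have [n [Nn En]] := H N; exists n; split => //; exact: HN.
have [s Hs] := choice Hk.
have Ls k : L2 mu (fn (s k)) /\ (E (fn (s k)) < c%:E)%E.
  by have [] := Hs k; rewrite /Eext; case: asboolP => // _; rewrite ltNge leey.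
exists (fun k => fn (s k)); split => [n|n|]; first exact: (Ls n).1.
  exact/ltW/(Ls n).2.
have := ae_cvg0_fast (mu := mu) (u := fun k => fn (s k)) (v := fun=> f) ndF (esym covF)
  (fun n => (HF n).1) (fun n => mfn (s n)) (fun=> mf) (fun k => (Hs k).2).
apply: aeS => x h; apply: (cvg_of_diff (b := fun=> f x)) => //; exact: cvg_cst.
Qed.

Lemma Ee_le f (c : \bar R) (fn : nat -> X -> R) : L0 f -> (forall n, L2 mu (fn n)) ->
  (forall n, (E (fn n) <= c)%E) -> {ae mu, forall x, fn n x @[n --> \oo] --> f x} ->
  (Ee mu E f <= c)%E.
Proof.
move=> mf Lfn Hfn cv.
have h : (limn_einf (fun n => Eext mu E (fn n)) <= c)%E.
  apply: limn_einf_le => N; exists N; split => //.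
  by rewrite /Eext asboolT.
apply: le_trans h; apply: ereal_inf_lbound; exists fn => //; split.
  by move=> n; case: (Lfn n).
move=> B eps mB fB e0; apply: ae_cvg_in_measure => //.
by move=> n; case: (Lfn n).
Qed.

Lemma Ee_ge0 f : (0 <= Ee mu E f)%E.
Proof.
apply: le_ereal_inf_tmp => _ [fn _ <-]; apply: (@limn_einf_ge _ _ 0%N) => n _.
by rewrite /Eext; case: asboolP => // h; exact: E_ge0.
Qed.

(** Diagonal argument: [ab.2] is a member of the given sequence close to [f], and [ab.1] is an L2
    approximant of that member. Both errors are controlled at rate [2^-k]. *)
Lemma Ee_lsc f (fn : nat -> X -> R) (c : R) : L0 f -> (forall n, L0 (fn n)) ->
  (forall N, exists n, (N <= n)%N /\ (Ee mu E (fn n) <= c%:E)%E) ->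
  {ae mu, forall x, fn n x @[n --> \oo] --> f x} -> (Ee mu E f <= c%:E)%E.
Proof.
move=> mf mfn H cv; apply/lee_addgt0Pr => e e0.
have [F [covF ndF HF]] := (sigma_finiteP _ _).1 sf.
have pw k : 0 < (2^-1 : R) ^+ k by rewrite exprn_gt0.
have Hk k : exists ab : (X -> R) * (X -> R), [/\ L2 mu ab.1, (E ab.1 <= (c + e)%:E)%E, L0 ab.2,
    (mu (F k `&` [set x | (2^-1 ^+ k < `|ab.1 x - ab.2 x|)%R]) <= (2^-1 ^+ k)%:E)%E &
    (mu (F k `&` [set x | (2^-1 ^+ k < `|ab.2 x - f x|)%R]) <= (2^-1 ^+ k)%:E)%E].
  have [N HN] := ereal_cvg0_small (ae_cvg_in_measure mfn mf cv (HF k).1 (HF k).2 (pw k)) (pw k).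
  have [n [Nn En]] := H N.
  have [|gm [Lg Eg cg]] := @Ee_lt (fn n) (c + e) (mfn n).
    by apply: le_lt_trans En _; rewrite lte_fin ltrDl.
  have mgm m : L0 (gm m) by case: (Lg m).
  have [M HM] := ereal_cvg0_small (ae_cvg_in_measure mgm (mfn n) cg (HF k).1 (HF k).2 (pw k)) (pw k).
  by exists (gm M, fn n); split => //=; [exact: HM|exact: HN].
have [s Hs] := choice Hk.
apply: (@Ee_le _ _ (fun k => (s k).1)) => //.
- by move=> n; have [] := Hs n.
- by move=> n; rewrite -EFinD; have [] := Hs n.
have m1 n : L0 (s n).1 by have [[]] := Hs n.
have m2 n : L0 (s n).2 by have [] := Hs n.
have h1 := ae_cvg0_fast (mu := mu) (u := fun k => (s k).1) (v := fun k => (s k).2) ndF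
  (esym covF) (fun n => (HF n).1) m1 m2 _.
have h2 := ae_cvg0_fast (mu := mu) (u := fun k => (s k).2) (v := fun k => f) ndF
  (esym covF) (fun n => (HF n).1) m2 (fun=> mf) _.
apply: aeS2 (h1 _) (h2 _).
- move=> x a1 a2; apply: (cvg_of_diff a1); apply: (cvg_of_diff a2); exact: cvg_cst.
- by move=> k; have [] := Hs k.
- by move=> k; have [] := Hs k.
Qed.

Lemma Ee_ae f g (c : R) : L0 f -> L0 g -> {ae mu, forall x, f x = g x} ->
  (Ee mu E f <= c%:E)%E -> (Ee mu E g <= c%:E)%E.
Proof.
move=> mf mg fg Ef; apply: (@Ee_lsc _ (fun=> f)) => //; first by move=> N; exists N.
by apply: aeS fg => x ->; exact: cvg_cst.
Qed.

Lemma Ee_approx f (c e : R) : L0 f -> (Ee mu E f <= c%:E)%E -> 0 < e ->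
  exists fn : nat -> X -> R, [/\ (forall n, L2 mu (fn n)), (forall n, (E (fn n) <= (c + e)%:E)%E) &
    {ae mu, forall x, fn n x @[n --> \oo] --> f x}].
Proof.
by move=> mf Ef e0; apply: Ee_lt => //; apply: le_lt_trans Ef _; rewrite lte_fin ltrDl.
Qed.

Lemma Ee_conv f g (a b t : R) : L0 f -> L0 g -> 0 <= t <= 1 ->
  (Ee mu E f <= a%:E)%E -> (Ee mu E g <= b%:E)%E ->
  (Ee mu E (fun x => t * f x + (1 - t) * g x)%R <= (t * a + (1 - t) * b)%:E)%E.
Proof.
move=> mf mg /andP[t0 t1] Ef Eg; apply/lee_addgt0Pr => e e0.
have [fn [Lf Efn cf]] := Ee_approx mf Ef e0.
have [gn [Lg Egn cg]] := Ee_approx mg Eg e0.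
apply: (@Ee_le _ _ (fun n x => t * fn n x + (1 - t) * gn n x)).
- by apply: L0D; exact: L0Z.
- by move=> n; exact: L2lin.
- move=> n; case: nE => _ [_ [_ [H _]]].
  apply: le_trans (H _ _ t (Lf n) (Lg n) _) _; first by rewrite t0 t1.
  have t10 : 0 <= 1 - t by lra.
  apply: le_trans (leeD (lee_wpmul2l _ (Efn n)) (lee_wpmul2l _ (Egn n))) _.
  - by rewrite lee_fin.
  - by rewrite lee_fin.
  by rewrite -!EFinM -!EFinD lee_fin; lra.
- apply: aeS2 cf cg => x c1 c2.
  by apply: cvgD; apply: cvgM => //; exact: cvg_cst.
Qed.

Lemma Ee_opp f (c : R) : L0 f -> (Ee mu E f <= c%:E)%E -> (Ee mu E (fun x => - f x)%R <= c%:E)%E.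
Proof.
move=> mf Ef; apply/lee_addgt0Pr => e e0.
have [fn [Lf Efn cf]] := Ee_approx mf Ef e0.
apply: (@Ee_le _ _ (fun n x => - fn n x)).
- exact: L0N.
- by move=> n; have := L2Z (-1) (Lf n); under eq_fun do rewrite mulN1r.
- by move=> n; case: nE => _ [_ [_ [_ [H _]]]]; rewrite H// -EFinD.
- by apply: aeS cf => x c1; exact: cvgN.
Qed.

Lemma Ee0 : Ee mu E (fun _ => 0)%R = 0%E.
Proof.
rewrite eE; last exact: L2_0.
by case: nE => _ [_ [_ [_ [_ [H _]]]]].
Qed.

Lemma Ee_scale f (a t : R) : L0 f -> 0 <= t <= 1 -> (Ee mu E f <= a%:E)%E ->
  (Ee mu E (fun x => t * f x)%R <= (t * a)%:E)%E.
Proof.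
move=> mf t01 Ef; have := @Ee_conv f (fun=> 0) a 0 t mf (L0cst 0) t01 Ef.
rewrite Ee0 lexx mulr0 addr0 => /(_ isT).
by under eq_fun do rewrite addr0.
Qed.

(* [i] will be the infimum of an obstacle problem whose constraint set contains
   the join of [u] and [v]. *)
Lemma Ee_submod u v (a b i : R) : L0 u -> L0 v ->
  (Ee mu E u <= a%:E)%E -> (Ee mu E v <= b%:E)%E ->
  (i%:E <= Ee mu E (fun x => Num.max (u x) (v x)))%E ->
  (Ee mu E (fun x => Num.min (u x) (v x)) <= (a + b - i)%:E)%E.
Proof.
move=> m_u m_v Eu Ev Hi; apply/lee_addgt0Pr => e e0.
have e4 : 0 < e / 4 by lra.
have [un [Lu Eun cu]] := Ee_approx m_u Eu e4.
have [vn [Lv Evn cv]] := Ee_approx m_v Ev e4.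
rewrite -EFinD; apply: (@Ee_lsc _ (fun n x => Num.min (un n x) (vn n x))).
- exact: L0min.
- by move=> n; apply: L0min; [case: (Lu n)|case: (Lv n)].
(* If all minima from [N] on had energy above [a + b - i + e], submodularity would push the maxima
   below [i - e / 2], and lower semicontinuity would contradict [Hi]. *)
- move=> N; apply: contrapT => /forallNP H.
  suff : (Ee mu E (fun x => Num.max (u x) (v x)) <= (i - e / 4)%:E)%E.
    by move=> /(le_trans Hi); rewrite lee_fin; lra.
  apply: (@Ee_lsc _ (fun n x => Num.max (un n x) (vn n x))).
  - exact: L0max.
  - by move=> n; apply: L0max; [case: (Lu n)|case: (Lv n)].
  - move=> M; exists (maxn N M); split; first exact: leq_maxr.
    set n := maxn N M.
    have LM := L2max (Lu n) (Lv n); have Lm := L2min (Lu n) (Lv n).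
    have /not_andP[|/negP] := H n; first by rewrite leq_maxl.
    rewrite -ltNge (eE LM) (eE Lm).
    have := E_submod (Lu n) (Lv n); have := Eun n; have := Evn n.
    have := E_ge0 LM; have := E_ge0 Lm; have := E_ge0 (Lu n); have := E_ge0 (Lv n).
    move: (E _) (E _) (E (un n)) (E (vn n)).
    move=> [x| |] [y| |] [z| |] [w| |]//; rewrite ?lee_fin ?lte_fin -?EFinD ?lee_fin; lra.
  - apply: aeS2 cu cv => x c1 c2.
    by apply: cvgn_max.
- apply: aeS2 cu cv => x c1 c2.
  by apply: cvgn_min.
Qed.

Lemma Delta2_Ee (K : R) : 0 <= K ->
  (forall f, L2 mu f -> (E (fun x => (2 * f x)%R) <= K%:E * E f)%E) ->
  forall f (c : R), L0 f -> (Ee mu E f <= c%:E)%E -> (Ee mu E (fun x => 2 * f x)%R <= (K * c)%:E)%E.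
Proof.
move=> K0 HK f c mf Ef; apply/lee_addgt0Pr => e e0.
(* Divided by [K + 1] rather than by [K], which may be 0. *)
have e1 : 0 < e / (K + 1) by rewrite divr_gt0//; lra.
have [fn [Lf Efn cf]] := Ee_approx mf Ef e1.
rewrite -EFinD; apply: (@Ee_le _ _ (fun n x => 2 * fn n x)).
- exact: L0Z.
- by move=> n; exact: L2Z.
- move=> n; apply: le_trans (HK _ (Lf n)) _.
  apply: le_trans (lee_wpmul2l _ (Efn n)) _; first by rewrite lee_fin.
  rewrite -EFinM lee_fin mulrDr lerD2l mulrCA -[leRHS]mulr1 ler_wpM2l//; first exact: ltW.
  by rewrite ler_pdivrMr ?mul1r; lra.
- by apply: aeS cf => x c1; apply: cvgM => //; exact: cvg_cst.
Qed.

End Form.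

(** * Resolvents and excessive functions *)
Section Resolvent.
Context (R : realType) (X : ptopologicalType)
        (mu : {measure set (borel X) -> \bar R}) (E : (X -> R) -> \bar R).
Hypothesis (sf : sigma_finite [set: borel X] mu).
Hypothesis (nE : nopf mu E) (eE : Ee_exists mu E).
Implicit Types f g u v w k : X -> R.

(** A squared norm as a real. [fine] sends an infinite integral to 0, so the comparisons below
    require L2. *)
Definition nrm2 f : R := fine (l2sq mu f).

Lemma nrm2_ge0 f : 0 <= nrm2 f.
Proof. by rewrite fine_ge0// l2sq_ge0. Qed.

Lemma nrm2_le4 (a b c e : R) f g k w :
  0 <= a -> 0 <= b -> 0 <= c -> 0 <= e ->
  L2 mu f -> L2 mu g -> L2 mu k -> L2 mu w ->
  {ae mu, forall x, a * f x ^+ 2 + b * g x ^+ 2 <= c * k x ^+ 2 + e * w x ^+ 2} ->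
  a * nrm2 f + b * nrm2 g <= c * nrm2 k + e * nrm2 w.
Proof.
move=> a0 b0 c0 e0 Lf Lg Lk Lw H.
rewrite -lee_fin !EFinD !EFinM -!L2_fin//; apply: integral_le4 => //.
- by apply: L0X; case: Lf.
- by apply: L0X; case: Lg.
- by apply: L0X; case: Lk.
- by apply: L0X; case: Lw.
- by move=> x; exact: sqr_ge0.
- by move=> x; exact: sqr_ge0.
- by move=> x; exact: sqr_ge0.
- by move=> x; exact: sqr_ge0.
Qed.

Lemma nrm2_le f g : L2 mu f -> L2 mu g -> {ae mu, forall x, f x ^+ 2 <= g x ^+ 2} ->
  nrm2 f <= nrm2 g.
Proof.
move=> Lf Lg H; have := @nrm2_le4 1 0 1 0 f f g g ler01 (lexx 0) ler01 (lexx 0) Lf Lf Lg Lg.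
rewrite !mul1r !mul0r !addr0; apply.
by apply: aeS H => x; rewrite !mul1r !mul0r !addr0.
Qed.

Lemma nrm2_le0 f : L2 mu f -> nrm2 f <= 0 -> {ae mu, forall x, f x = 0}.
Proof.
move=> Lf f0; have [mf _] := Lf.
have := @ae_cvg0_summable _ _ _ mu (fun _ x => f x ^+ 2) 0 (fun=> L0X 2 mf)
  (fun _ x => sqr_ge0 (f x)).
have H : forall n : nat, (\int[mu]_x (f x ^+ 2)%:E <= (0 * 2^-1 ^+ n)%:E)%E.
  by move=> n; rewrite mul0r -/(l2sq mu f) (L2_fin Lf) lee_fin.
move=> /(_ H); apply: aeS => x /(cvg_lim (@Rhausdorff R)).
by rewrite lim_cst// => /eqP; rewrite sqrf_eq0 => /eqP.
Qed.

Lemma E_conv (t a b : R) f g : 0 <= t <= 1 -> L2 mu f -> L2 mu g ->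
  (E f <= a%:E)%E -> (E g <= b%:E)%E ->
  (E (fun x => t * f x + (1 - t) * g x)%R <= (t * a + (1 - t) * b)%:E)%E.
Proof.
move=> t01 Lf Lg Ef Eg; case: nE => _ [_ [_ [H _]]].
apply: le_trans (H _ _ t Lf Lg t01) _.
case/andP: t01 => t0 t1; rewrite [leRHS]EFinD; apply: leeD; rewrite EFinM lee_wpmul2l// lee_fin.
by rewrite subr_ge0.
Qed.

(** Moreau's proximal point of [w]; the resolvent at [f] is the case [w = alpha^-1 * f]. Centring at
    [w] makes pointwise comparisons with the obstacle direct. *)
Definition prox (alpha : R) w g : Prop := L2 mu g /\ forall k, L2 mu k ->
  (E g + (alpha / 2)%:E * l2sq mu (fun x => (g x - w x)%R)
    <= E k + (alpha / 2)%:E * l2sq mu (fun x => (k x - w x)%R))%E.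

Lemma resolvent_prox (alpha : R) f g :
  resolvent mu E alpha f g <-> prox alpha (fun x => alpha^-1 * f x) g.
Proof. by []. Qed.

Lemma prox_fin (alpha : R) w g : L2 mu w -> 0 < alpha -> prox alpha w g ->
  E g = (fine (E g))%:E.
Proof.
move=> Lw a0 [Lg /(_ _ (L2_0 mu)) H].
rewrite fineK// ge0_fin_numE; last exact: E_ge0 nE _ Lg.
apply: (@le_lt_trans _ _ (E g + (alpha / 2)%:E * l2sq mu (fun x => (g x - w x)%R))%E).
  by rewrite leeDl// mule_ge0 ?l2sq_ge0// lee_fin divr_ge0// ltW.
apply: le_lt_trans H _.
rewrite (L2_fin (L2B (L2_0 mu) Lw)).
by case: nE => _ [_ [_ [_ [_ [-> _]]]]]; rewrite add0e -EFinM ltry.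
Qed.

Lemma prox_le (alpha c : R) w g k : L2 mu w -> 0 < alpha -> prox alpha w g -> L2 mu k ->
  (E k <= c%:E)%E ->
  fine (E g) + alpha / 2 * nrm2 (fun x => g x - w x) <= c + alpha / 2 * nrm2 (fun x => k x - w x).
Proof.
move=> Lw a0 pg Lk Ek; rewrite -lee_fin !EFinD -(prox_fin Lw a0 pg) !EFinM.
case: pg => Lg /(_ k Lk).
rewrite (L2_fin (L2B Lg Lw)) (L2_fin (L2B Lk Lw)) => H; apply: le_trans H _.
by rewrite leeD2r.
Qed.

Lemma le_of_vanishing (a b c : R) : 0 <= c ->
  (forall t, 0 < t < 1 -> a - t * c <= b) -> a <= b.
Proof.
move=> c0 H; apply/ler_addgt0Pr => e e0.
have d0 : 0 < c + 1 + e by lra.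
have t0 : 0 < e / (c + 1 + e) by rewrite divr_gt0.
have t1 : e / (c + 1 + e) < 1 by rewrite ltr_pdivrMr//; lra.
have := H (e / (c + 1 + e)); rewrite t0 t1 => /(_ isT) h.
suff : e / (c + 1 + e) * c <= e by lra.
by rewrite mulrAC ler_pdivrMr// ler_wpM2l; lra.
Qed.

(** Strong convexity of the quadratic term. The minimizer is compared with [t * k + (1 - t) * g];
    after division by [t] the gap between [k] and [g] appears with factor [1 - t], and [t] tends to
    0. A vanishing gap later yields the pointwise comparisons. *)
Lemma prox_strong (alpha c : R) w g k : L2 mu w -> 0 < alpha -> prox alpha w g -> L2 mu k ->
  (E k <= c%:E)%E ->
  fine (E g) + alpha / 2 * nrm2 (fun x => g x - w x) + alpha / 2 * nrm2 (fun x => k x - g x)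
    <= c + alpha / 2 * nrm2 (fun x => k x - w x).
Proof.
move=> Lw a0 pg Lk Ek; have [Lg _] := pg.
have Eg : (E g <= (fine (E g))%:E)%E by rewrite -(prox_fin Lw a0 pg).
apply: (@le_of_vanishing _ _ (alpha / 2 * nrm2 (fun x => k x - g x))).
  by rewrite mulr_ge0 ?nrm2_ge0// divr_ge0// ltW.
move=> t /andP[t0 t1].
have t10 : 0 <= 1 - t by lra.
have Em : (E (fun x => t * k x + (1 - t) * g x)%R <= (t * c + (1 - t) * fine (E g))%:E)%E.
  by apply: E_conv => //; rewrite (ltW t0) (ltW t1).
have := prox_le Lw a0 pg (L2lin t (1 - t) Lk Lg) Em.
have : 1 * nrm2 (fun x => t * k x + (1 - t) * g x - w x) + t * (1 - t) * nrm2 (fun x => k x - g x)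
    <= t * nrm2 (fun x => k x - w x) + (1 - t) * nrm2 (fun x => g x - w x).
  apply: nrm2_le4 => //.
  - by rewrite mulr_ge0// ltW.
  - exact: ltW.
  - exact: L2B (L2lin _ _ Lk Lg) Lw.
  - exact: L2B.
  - exact: L2B.
  - exact: L2B.
  - by apply: aeW => x; rewrite le_eqVlt; apply/orP; left; apply/eqP; ring.
move: (nrm2 _) (nrm2 _) (nrm2 _) (nrm2 _) (fine _) => m d p q e h1 h2.
have a20 : 0 < alpha / 2 by lra.
have {}h1 : alpha / 2 * q <= alpha / 2 * (t * d + (1 - t) * m - t * (1 - t) * p).
  by rewrite ler_wpM2l//; [exact: ltW|lra].
rewrite -(ler_pM2l t0).
by lra.
Qed.

(** [max(g1, g2)] competes with [g2] and [min(g1, g2)] with [g1]. The energies do not grow by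
    submodularity, nor the quadratic terms because [w1 <= w2]. Adding the two inequalities leaves
    only the gap between the minimum and [g1], which must vanish. *)
Lemma prox_mono (alpha : R) w1 w2 g1 g2 : 0 < alpha -> L2 mu w1 -> L2 mu w2 ->
  {ae mu, forall x, w1 x <= w2 x} -> prox alpha w1 g1 -> prox alpha w2 g2 ->
  {ae mu, forall x, g1 x <= g2 x}.
Proof.
move=> a0 Lw1 Lw2 w12 p1 p2; have [Lg1 _] := p1; have [Lg2 _] := p2.
have Lm := L2min Lg1 Lg2; have LM := L2max Lg1 Lg2.
have := E_submod nE Lg1 Lg2.
rewrite (prox_fin Lw1 a0 p1) (prox_fin Lw2 a0 p2).
have := E_ge0 nE Lm; have := E_ge0 nE LM.
case EM : (E (fun x => Num.max (g1 x) (g2 x))) => [eM| |]//; last first.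
  by case: (E _).
case Em : (E (fun x => Num.min (g1 x) (g2 x))) => [em| |]//.
move=> _ _; rewrite -!EFinD lee_fin => sub.
have EM' : (E (fun x => Num.max (g1 x) (g2 x)) <= eM%:E)%E by rewrite EM.
have Em' : (E (fun x => Num.min (g1 x) (g2 x)) <= em%:E)%E by rewrite Em.
have h2 := prox_le Lw2 a0 p2 LM EM'.
have h1 := prox_strong Lw1 a0 p1 Lm Em'.
have : 1 * nrm2 (fun x => Num.min (g1 x) (g2 x) - w1 x) +
       1 * nrm2 (fun x => Num.max (g1 x) (g2 x) - w2 x) <=
    1 * nrm2 (fun x => g1 x - w1 x) + 1 * nrm2 (fun x => g2 x - w2 x).
  apply: nrm2_le4 => //; do ?exact: L2B.
  apply: aeS w12 => x h; case: (leP (g1 x) (g2 x)) => gg; first by lra.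
  have : 0 <= (g1 x - g2 x) * (w2 x - w1 x) by rewrite mulr_ge0// subr_ge0// ltW.
  by lra.
rewrite !mul1r => h3.
suff : nrm2 (fun x => Num.min (g1 x) (g2 x) - g1 x) <= 0.
  move=> /(nrm2_le0 (L2B Lm Lg1)); apply: aeS => x /eqP; rewrite subr_eq0 => /eqP <-.
  by rewrite ge_min lexx orbT.
have a20 : 0 < alpha / 2 by lra.
rewrite -(pmulr_rle0 _ a20).
have := ler_wpM2l (ltW a20) h3.
by lra.
Qed.

(** A minimizing sequence is made fast enough to converge almost everywhere; Fatou and lower
    semicontinuity of [Ee] then replace completeness of L2. *)
Lemma prox_exists (alpha : R) w : 0 < alpha -> L2 mu w -> exists g, prox alpha w g.
Proof.
move=> a0 Lw; have a20 : 0 < alpha / 2 by lra.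
pose J k := (E k + (alpha / 2)%:E * l2sq mu (fun x => (k x - w x)%R))%E.
pose S := [set J k | k in [set k | L2 mu k]].
have J0 k : L2 mu k -> (0 <= J k)%E.
  by move=> Lk; rewrite adde_ge0 ?mule_ge0 ?l2sq_ge0 ?(E_ge0 nE)// lee_fin ltW.
have Sfin : ereal_inf S \is a fin_num.
  rewrite ge0_fin_numE; last by apply: le_ereal_inf_tmp => _ [k Lk <-]; exact: J0.
  apply: (@le_lt_trans _ _ (J (fun=> 0))).
    by apply: ereal_inf_lbound; exists (fun=> 0) => //; exact: L2_0.
  rewrite /J (L2_fin (L2B (L2_0 mu) Lw)).
  by case: nE => _ [_ [_ [_ [_ [-> _]]]]]; rewrite add0e -EFinM ltry.
pose i := fine (ereal_inf S).
have iS k (c : R) : L2 mu k -> (E k <= c%:E)%E -> i <= c + alpha / 2 * nrm2 (fun x => k x - w x).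
  move=> Lk Ek; rewrite -lee_fin fineK//.
  apply: (@le_trans _ _ (J k)); first by apply: ereal_inf_lbound; exists k.
  by rewrite /J (L2_fin (L2B Lk Lw)) -EFinM EFinD leeD2r.
(* Near-minimality at rate [8^-n] makes the squared increments [O(8^-n)] through the midpoint. The
   weight [4^n], which detects increments of size [2^-n], still leaves the summable [2^-n]. *)
have Hn n : exists kc : (X -> R) * R, [/\ L2 mu kc.1, (E kc.1 <= kc.2%:E)%E &
    kc.2 + alpha / 2 * nrm2 (fun x => kc.1 x - w x) <= i + 8^-1 ^+ n].
  have e0 : 0 < 8^-1 ^+ n :> R by rewrite exprn_gt0.
  have [_ [k Lk <-] Jk] := lb_ereal_inf_adherent e0 Sfin.
  move: Jk; rewrite /J (L2_fin (L2B Lk Lw)) -/(nrm2 _) -(fineK Sfin) -/i.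
  have := E_ge0 nE Lk; case Ek : (E k) => [c| |]// _; rewrite -EFinM -!EFinD lte_fin => h.
  by exists (k, c); split => //=; [rewrite Ek|exact: ltW].
have [s Hs] := choice Hn.
pose k n := (s n).1; pose c n := (s n).2.
have Lk n : L2 mu (k n) by have [] := Hs n.
have Ek n : (E (k n) <= (c n)%:E)%E by have [] := Hs n.
have Jk n : c n + alpha / 2 * nrm2 (fun x => k n x - w x) <= i + 8^-1 ^+ n by have [] := Hs n.
have c0 n : 0 <= c n by rewrite -lee_fin; apply: le_trans (Ek n); exact: E_ge0 nE _ (Lk n).
have e8 n : 8^-1 ^+ n.+1 <= 8^-1 ^+ n :> R.
  by rewrite exprS ger_pMl ?exprn_gt0// invf_le1// ler1n.
have dk n : nrm2 (fun x => k n.+1 x - k n x) <= (8 / alpha) * 8^-1 ^+ n.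
  have Em : (E (fun x => 2^-1 * k n.+1 x + (1 - 2^-1) * k n x)%R <=
      (2^-1 * c n.+1 + (1 - 2^-1) * c n)%:E)%E.
    by apply: E_conv => //; apply/andP; split; lra.
  have h1 := iS _ _ (L2lin _ _ (Lk n.+1) (Lk n)) Em.
  have h2 : 1 * nrm2 (fun x => 2^-1 * k n.+1 x + (1 - 2^-1) * k n x - w x) +
      4^-1 * nrm2 (fun x => k n.+1 x - k n x) <=
      2^-1 * nrm2 (fun x => k n.+1 x - w x) + 2^-1 * nrm2 (fun x => k n x - w x).
    apply: nrm2_le4 => //.
    - exact: L2B (L2lin _ _ (Lk n.+1) (Lk n)) Lw.
    - exact: L2B.
    - exact: L2B.
    - exact: L2B.
    - by apply: aeW => x; rewrite le_eqVlt; apply/orP; left; apply/eqP; field.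
  have := ler_wpM2l (ltW a20) h2.
  have := Jk n; have := Jk n.+1; have := e8 n.
  move: h1; move: (nrm2 _) (nrm2 _) (nrm2 _) (nrm2 _) => m d p q h1 h3 h4 h5 h6.
  rewrite mulrAC ler_pdivlMr//; lra.
have cvk : {ae mu, forall x, cvgn (fun n => k n x)}.
  have := @ae_cvg0_summable _ _ _ mu (fun n x => 4 ^+ n * (k n.+1 x - k n x) ^+ 2) (8 / alpha).
  have H1 n : measurable_fun [set: borel X] (fun x => 4 ^+ n * (k n.+1 x - k n x) ^+ 2 : R).
    by apply: L0Z; apply: L0X; apply: L0B; [case: (Lk n.+1)|case: (Lk n)].
  have H2 n x : 0 <= 4 ^+ n * (k n.+1 x - k n x) ^+ 2 by rewrite mulr_ge0 ?sqr_ge0// exprn_ge0.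
  move=> /(_ H1 H2); have H3 n : (\int[mu]_x (4 ^+ n * (k n.+1 x - k n x) ^+ 2)%:E <=
      (8 / alpha * 2^-1 ^+ n)%:E)%E.
    under eq_integral do rewrite EFinM.
    rewrite ge0_integralZl//; last 2 first.
    - by apply/measurable_EFinP; apply: L0X; apply: L0B; [case: (Lk n.+1)|case: (Lk n)].
    - by move=> x _; rewrite lee_fin sqr_ge0.
    rewrite -/(l2sq mu (fun x => k n.+1 x - k n x)) (L2_fin (L2B (Lk n.+1) (Lk n))).
    rewrite -EFinM lee_fin; apply: le_trans (ler_wpM2l _ (dk n)) _; first by rewrite exprn_ge0.
    rewrite mulrCA -exprMn; have -> : 4 * 8^-1 = 2^-1 :> R by field.
    exact: lexx.
  move=> /(_ H3); apply: aeS => x cx.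
  have /cvgrPdist_le/(_ 1 ltr01)[N _ HN] := cx.
  apply: (@cvgn_geometric_increments _ _ N) => n Nn.
  have := HN n Nn; rewrite /= sub0r normrN ger0_norm// => h.
  have p4 : 0 < 2 ^+ n :> R by rewrite exprn_gt0.
  rewrite -(ler_pM2l p4) -exprMn mulfV// expr1n.
  rewrite -(@ler_pXn2r _ 2)// ?nnegrE ?mulr_ge0// ?exprn_ge0//.
  by rewrite expr1n exprMn exprAC real_normK ?num_real// -[2 ^+ 2]/(2 * 2) (_ : 2 * 2 = 4)//; ring.
pose g x := fine (limn_einf (fun n => (k n x)%:E)).
have mg : L0 g.
  apply: measurableT_comp; first exact: fine_measurable.
  by apply: measurable_fun_limn_einf => n; apply/measurable_EFinP; case: (Lk n).
have kg : {ae mu, forall x, k n x @[n --> \oo] --> g x}.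
  by apply: aeS cvk => x; exact: cvgn_fine_limn_einf.
have bnd n : nrm2 (fun x => k n x - w x) <= (i + 1) * 2 / alpha.
  have := Jk n; have := c0 n.
  have : 8^-1 ^+ n <= 1 :> R by rewrite exprn_ile1// invf_le1// ler1n.
  move=> h1 h2 h3; rewrite ler_pdivlMr//; lra.
have Lg : L2 mu g.
  split => //; apply: le_lt_trans (_ : _ <= (2 * ((i + 1) * 2 / alpha) + 2 * nrm2 w)%:E)%E _; last exact: ltry.
  apply: (@fatou_ae _ _ _ mu (fun n x => k n x ^+ 2)).
  - by move=> n; apply: L0X; case: (Lk n).
  - exact: L0X.
  - by move=> n x; exact: sqr_ge0.
  - by move=> x; exact: sqr_ge0.
  - by apply: aeS kg => x cx; rewrite expr2; under eq_fun do rewrite expr2; exact: cvgM.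
  - move=> N; exists N; split => //; rewrite -/(l2sq mu (k N)) (L2_fin (Lk N)) lee_fin -/(nrm2 _).
    have h : 1 * nrm2 (k N) + 0 * nrm2 (k N) <= 2 * nrm2 (fun x => k N x - w x) + 2 * nrm2 w.
      apply: nrm2_le4 => //; first exact: L2B.
      apply: aeW => x; have : 0 <= (k N x - 2 * w x) ^+ 2 by exact: sqr_ge0.
      by lra.
    by have := bnd N; lra.
exists g; split => // k' Lk'.
apply: (@le_trans _ _ i%:E); last first.
  by rewrite fineK//; apply: ereal_inf_lbound; exists k'.
rewrite (L2_fin (L2B Lg Lw)) -/(nrm2 _) -EFinM -leeBrDr// -EFinB.
apply/lee_addgt0Pr => e e0.
rewrite -(eE Lg) -EFinD; apply: (@Ee_lsc _ _ _ _ sf _ k) => //.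
- by move=> n; case: (Lk n).
(* Energy and distance are controlled only jointly. If the energies stayed above the target, the
   squared distances to [w] would eventually lie below that of [g] by [e / alpha], against Fatou. *)
- move=> N; apply: contrapT => /forallNP H.
  have e2 : 0 < e / 2 by lra.
  have : 8^-1 ^+ n @[n --> \oo] --> (0 : R).
    by apply: cvg_expr; rewrite ger0_norm// invf_lt1// ltr1n.
  move=> /cvgrPdist_le/(_ _ e2)[M _ HM].
  suff : (l2sq mu (fun x => g x - w x)%R <= (nrm2 (fun x => g x - w x) - e / alpha)%:E)%E.
    rewrite (L2_fin (L2B Lg Lw)) lee_fin -/(nrm2 _).
    have : 0 < e / alpha by rewrite divr_gt0.
    by lra.
  apply: (@fatou_ae _ _ _ mu (fun n x => (k n x - w x) ^+ 2)).
  - by move=> n; apply: L0X; apply: L0B; [case: (Lk n)|case: Lw].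
  - by apply: L0X; apply: L0B => //; case: Lw.
  - by move=> n x; exact: sqr_ge0.
  - by move=> x; exact: sqr_ge0.
  - apply: aeS kg => x cx; rewrite expr2; under eq_fun do rewrite expr2.
    by apply: cvgM; apply: cvgB => //; exact: cvg_cst.
  - move=> N'; pose n := maxn N' (maxn N M); exists n; split; first exact: leq_maxl.
    have nN : (N <= n)%N by rewrite /n !leq_max leqnn orbT.
    have nM : (M <= n)%N by rewrite /n !leq_max leqnn !orbT.
    have := HM n nM; rewrite /= sub0r normrN ger0_norm ?exprn_ge0// => h8.
    have /not_andP[//|/negP] := H n; rewrite -ltNge (eE (Lk n)) => /lt_le_trans/(_ (Ek n)).
    rewrite lte_fin => hc; have := Jk n.
    rewrite -/(l2sq mu (fun x => k n x - w x)) (L2_fin (L2B (Lk n) Lw)) lee_fin -/(nrm2 _).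
    move=> h; rewrite -(ler_pM2l a20) mulrBr.
    have -> : alpha / 2 * (e / alpha) = e / 2 by field; rewrite gt_eqF.
    by lra.
Qed.

(** The minimum of the minimizer with [e] has no more energy, and it is no farther from the centre
    because the centre lies below [e]. By [prox_strong] it equals the minimizer, so every
    approximating resolvent is at most [e]. *)
Lemma excessive_of_truncation (e : X -> R) : L0 e -> (forall x, 0 <= e x) ->
  (forall f (c : R), L2 mu f -> (E f <= c%:E)%E -> (E (fun x => Num.min (f x) (e x)) <= c%:E)%E) ->
  excessive mu E e.
Proof.
move=> me e0 He; split => //; split => // alpha u a0 [fn [gn [Lfn [rfn [cfn cgn]]]]].
have ge n : {ae mu, forall x, gn n x <= e x}.
  pose w x := alpha^-1 * fn n x.
  have Lw : L2 mu w by exact: L2Z.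
  have pg : prox alpha w (gn n) := rfn n.
  have [Lg _] := pg.
  have Lm := L2min_nneg Lg me e0.
  have Em : (E (fun x => Num.min (gn n x) (e x)) <= (fine (E (gn n)))%:E)%E.
    by apply: He => //; rewrite -(prox_fin Lw a0 pg).
  have h := prox_strong Lw a0 pg Lm Em.
  have we : {ae mu, forall x, w x <= e x}.
    apply: aeS cfn => x [mono cx]; rewrite /w ler_pdivrMl//.
    have nd : nondecreasing_seq (fn ^~ x) by apply/nondecreasing_seqP => m; exact: (mono m).2.
    have := nondecreasing_cvgn_le nd (cvgP _ cx) n.
    by rewrite (cvg_lim (@Rhausdorff R) cx).
  have h2 : nrm2 (fun x => Num.min (gn n x) (e x) - w x) <= nrm2 (fun x => gn n x - w x).
    apply: nrm2_le; [exact: L2B|exact: L2B|].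
    apply: aeS we => x wx; case: (leP (gn n x) (e x)) => // eg.
    by rewrite lerXn2r// ?nnegrE; lra.
  suff : nrm2 (fun x => Num.min (gn n x) (e x) - gn n x) <= 0.
    move=> /(nrm2_le0 (L2B Lm Lg)); apply: aeS => x /eqP; rewrite subr_eq0 => /eqP <-.
    by rewrite ge_min lexx orbT.
  have a20 : 0 < alpha / 2 by lra.
  rewrite -(pmulr_rle0 _ a20).
  have := ler_wpM2l (ltW a20) h2.
  by lra.
apply: aeS2 (ae_foralln ge) cgn => x gx cx.
apply: (cvge_to_le cx); apply: nearW => n; by rewrite lee_fin.
Qed.

(** * Truncation by an excessive function *)

Lemma L2_indic (A : set (borel X)) (c : R) : measurable A -> (mu A < +oo)%E ->
  L2 mu (fun x => c * \1_A x).
Proof.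
move=> mA fA.
have m1 : L0 (fun x : X => \1_A x : R) by exact: measurable_indic.
suff L1 : L2 mu (fun x => \1_A x) by exact: L2Z.
split => //; rewrite /l2sq.
under eq_integral => x _.
  have -> : (\1_A x : R) ^+ 2 = \1_A x by rewrite indicE; case: (_ \in _); rewrite ?expr1n ?expr0n.
  over.
by rewrite integral_indic// setIT.
Qed.

Lemma cvgn_min_divergent (e : R) (a : nat -> R) : (forall M, \forall n \near \oo, M <= a n) ->
  Num.min (a n) e @[n --> \oo] --> e.
Proof.
move=> Ha; apply: cvg_near_cst; apply: filterS (Ha e) => n h.
by rewrite min_r.
Qed.

(** Excessivity speaks only of resolvents of [alpha * e] as monotone limits. Such a limit is built
    from L2 functions that start above [min(f, e)], and [prox_mono] places [g] below the first of
    their proximal points. *)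
Lemma excessive_prox_le (e : X -> R) (alpha : R) f g : excessive mu E e -> 0 < alpha ->
  L2 mu f -> prox alpha (fun x => Num.min (f x) (e x)) g -> {ae mu, forall x, g x <= e x}.
Proof.
move=> [me [e0 He]] a0 Lf pg.
have Lw := L2min_nneg Lf me e0.
have [F [covF ndF HF]] := (sigma_finiteP _ _).1 sf.
(* The cutoffs [n * 1_(F n)], capped by [e], increase to [e]. The second entry puts [v 0] above
   [min(f, e)] and is at most [e]; its maximum with 0 serves negative values of [f]. *)
pose v n x := Num.max (Num.min (n%:R * \1_(F n) x) (e x)) (Num.max 0 (Num.min (f x) (e x))).
have Lv n : L2 mu (v n).
  apply: L2max; last by apply: L2max => //; exact: L2_0.
  by apply: L2min_nneg => //; apply: L2_indic; [exact: (HF n).1|exact: (HF n).2].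
have v0 n x : 0 <= v n x by rewrite /v !le_max lexx/= orbT.
have i0 n x : 0 <= n%:R * \1_(F n) x :> R by rewrite mulr_ge0.
have vmono n x : v n x <= v n.+1 x.
  rewrite /v; apply: le_max2 => //; apply: le_min2 => //.
  rewrite !indicE; have [/set_mem xF|] := boolP (x \in F n); last by rewrite mulr0 mulr_ge0.
  rewrite mem_set ?mulr1 ?ler_nat//.
  by have : (F n <= F n.+1)%O by [exact: ndF]; rewrite subsetEset; exact.
have vcv x : v n x @[n --> \oo] --> e x.
  have -> : e x = Num.max (e x) (Num.max 0 (Num.min (f x) (e x))).
    by rewrite max_l// ge_max e0/= ge_min lexx orbT.
  apply: cvgn_max; last exact: cvg_cst.
  apply: cvgn_min_divergent => M.
  have [j _ Fj] : (\bigcup_i F i) x by rewrite -covF.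
  near=> n; rewrite indicE mem_set.
    rewrite mulr1; apply: le_trans (_ : (Num.truncn M).+1%:R <= _).
      exact/ltW/truncnS_gt.
    by rewrite ler_nat; near: n; exact: nbhs_infty_ge.
  have : (F j <= F n)%O by apply: ndF; near: n; exact: nbhs_infty_ge.
  by rewrite subsetEset; exact.
have [gn Hgn] := choice (fun n => prox_exists a0 (Lv n)).
have gmono : {ae mu, forall x, forall n, gn n x <= gn n.+1 x}.
  apply: ae_foralln => n.
  by apply: (prox_mono a0 (Lv n) (Lv n.+1) _ (Hgn n) (Hgn n.+1)); apply: aeW.
have gle : {ae mu, forall x, g x <= gn 0%N x}.
  apply: (prox_mono a0 Lw (Lv 0%N) _ pg (Hgn 0%N)); apply: aeW => x.
  by rewrite /v !le_max lexx !orbT.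
pose u x := ereal_sup (range (fun n => (gn n x)%:E)).
have ue : {ae mu, forall x, (u x <= (e x)%:E)%E}.
  apply: (He alpha) => //; exists (fun n x => alpha * v n x), gn; split; [|split; [|split]].
  - by move=> n; exact: L2Z.
  - move=> n; apply/resolvent_prox.
    by under eq_fun do rewrite mulKf ?gt_eqF//; exact: Hgn.
  - apply: aeW => x; split; last by apply: cvgM; [exact: cvg_cst|exact: vcv].
    by move=> n; split; [rewrite mulr_ge0// ltW|rewrite ler_wpM2l// ltW].
  - apply: aeS gmono => x gx; apply: ereal_nondecreasing_cvgn.
    by apply/nondecreasing_seqP => n; rewrite lee_fin.
apply: aeS2 ue gle => x ux gx; apply: le_trans gx _; rewrite -lee_fin.
by apply: le_trans ux; apply: ereal_sup_ubound; exists 0%N.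
Unshelve. all: by end_near. Qed.

(** The proximal points [g n] of [w = min(fn N, e)] stay below [e], hence are pointwise at least as
    far from [fn N] as [w] is. Testing [g n] against [fn N] therefore leaves
    [E (g n) + 2^n * |g n - w|^2 <= c + d], which forces [g n] to converge to [w]. *)
Lemma excessive_truncation (e : X -> R) f (c : R) : excessive mu E e -> L0 f ->
  (Ee mu E f <= c%:E)%E -> (Ee mu E (fun x => Num.min (f x) (e x)) <= c%:E)%E.
Proof.
move=> xe mf Ef; have [me [e0 _]] := xe.
apply/lee_addgt0Pr => d d0; rewrite -EFinD.
have [fn [Lfn Efn cf]] := Ee_approx sf mf Ef d0.
have Lm n := L2min_nneg (Lfn n) me e0.
apply: (@Ee_lsc _ _ _ _ sf _ (fun n x => Num.min (fn n x) (e x))).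
- exact: L0min.
- by move=> n; case: (Lm n).
- move=> N; exists N; split => //; set w := (fun x => Num.min (fn N x) (e x)).
  (* With this parameter [alpha / 2] is exactly [2^n], the inverse of the summable rate used
     below. *)
  have a0 n : 0 < 2 * 2 ^+ n :> R by rewrite mulr_gt0// exprn_gt0.
  have [g Hg] := choice (fun n => prox_exists (a0 n) (Lm N)).
  have Lg n : L2 mu (g n) by have [] := Hg n.
  have key n : fine (E (g n)) + 2 ^+ n * nrm2 (fun x => g n x - w x) <= c + d.
    have h := @prox_strong (2 * 2 ^+ n) (c + d) w (g n) (fn N) (Lm N) (a0 n) (Hg n) (Lfn N) (Efn N).
    have h2 : nrm2 (fun x => fn N x - w x) <= nrm2 (fun x => fn N x - g n x).
      apply: nrm2_le; [exact: L2B (Lfn N) (Lm N)|exact: L2B (Lfn N) (Lg n)|].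
      apply: aeS (excessive_prox_le xe (a0 n) (Lfn N) (Hg n)) => x gx; rewrite /w.
      case: (leP (fn N x) (e x)) => fe; first by rewrite subrr expr0n sqr_ge0.
      by rewrite lerXn2r// ?nnegrE; lra.
    by have := ler_wpM2l (ltW (a0 n)) h2; lra.
  have Eg0 n : 0 <= fine (E (g n)) by rewrite fine_ge0// (E_ge0 nE).
  apply: (@Ee_le _ _ _ _ _ _ g) => //.
  - by case: (Lm N).
  - move=> n; rewrite (prox_fin (Lm N) (a0 n) (Hg n)) lee_fin.
    have := key n; have : 0 <= 2 ^+ n * nrm2 (fun x => g n x - w x).
      by rewrite mulr_ge0 ?nrm2_ge0 ?exprn_ge0.
    by lra.
  - have := @ae_cvg0_summable _ _ _ mu (fun n x => (g n x - w x) ^+ 2) (c + d).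
    have H1 n : measurable_fun [set: borel X] (fun x => (g n x - w x) ^+ 2 : R).
      by apply: L0X; apply: L0B; [case: (Lg n)|case: (Lm N)].
    have H2 n x : 0 <= (g n x - w x) ^+ 2 by exact: sqr_ge0.
    have H3 n : (\int[mu]_x ((g n x - w x) ^+ 2)%:E <= ((c + d) * 2^-1 ^+ n)%:E)%E.
      rewrite -/(l2sq mu (fun x => g n x - w x)) (L2_fin (L2B (Lg n) (Lm N))) lee_fin.
      have p2 : 0 < 2 ^+ n :> R by rewrite exprn_gt0.
      rewrite -/(nrm2 _) exprVn ler_pdivlMr// mulrC.
      by have := key n; have := Eg0 n; lra.
    move=> /(_ H1 H2 H3); apply: aeS => x h.
    apply: (@cvg_of_diff _ _ (fun=> w x)); last exact: cvg_cst.
    apply/cvgrPdist_le => t t0.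
    have t20 : 0 < t ^+ 2 by rewrite exprn_gt0.
    have /cvgrPdist_le/(_ _ t20) := h; apply: filterS => n.
    rewrite !sub0r !normrN normrX => hh.
    by rewrite -(@ler_pXn2r _ 2)// ?nnegrE// ltW.
- by apply: aeS cf => x cx; apply: cvgn_min => //; exact: cvg_cst.
Qed.

End Resolvent.

(** * Subcriticality *)
Section Subcritical.
Context (R : realType) (X : ptopologicalType)
        (mu : {measure set (borel X) -> \bar R}) (E : (X -> R) -> \bar R).
Hypothesis (sf : sigma_finite [set: borel X] mu).
Hypothesis (nE : nopf mu E) (eE : Ee_exists mu E).
Implicit Types f g u v w k : X -> R.

(** Minimality of [g] is tested against [max(k, g)], whose energy is at most [E k + E g]. Where
    [k > g], expanding the squares bounds [f * (k - g)] by [alpha / 2 * k^2] and the difference of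
    the quadratic terms. The absolute value makes the integrand nonnegative at every point. *)
Lemma resolvent_weight_le (alpha c : R) f g k : 0 < alpha -> L2 mu f ->
  {ae mu, forall x, 0 <= f x} -> resolvent mu E alpha f g -> L2 mu k -> (E k <= c%:E)%E ->
  (\int[mu]_x (`|f x| * Num.max (k x - Num.max (g x) 0) 0)%:E
    <= (c + alpha / 2 * nrm2 mu k)%:E)%E.
Proof.
move=> a0 Lf f0 pg Lk Ek; have [Lg _] := pg.
pose w x := alpha^-1 * f x.
have Lw : L2 mu w by exact: L2Z.
have {}pg : prox mu E alpha w g by [].
have a20 : 0 < alpha / 2 by lra.
pose M x := Num.max (k x) (g x).
have LM : L2 mu M by exact: L2max.
have EM : (E M <= (c + fine (E g))%:E)%E.
  apply: le_trans (_ : _ <= E k + E g)%E _.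
    apply: le_trans (E_submod nE Lk Lg); rewrite leeDl//.
    by apply: (E_ge0 nE); exact: L2min.
  by rewrite EFinD (prox_fin nE Lw a0 pg) leeD2r.
have h := prox_le nE Lw a0 pg LM EM.
have mf : L0 f by case: Lf.
have mk : L0 k by case: Lk.
have mg : L0 g by case: Lg.
have mp : L0 (fun x => `|f x| * Num.max (k x - Num.max (g x) 0) 0).
  apply: L0M; first exact: L0abs.
  apply: L0max; last exact: L0cst.
  by apply: L0B => //; apply: L0max => //; exact: L0cst.
have := @integral_le4 _ _ mu 1 (alpha / 2) (alpha / 2) (alpha / 2)
  (fun x => `|f x| * Num.max (k x - Num.max (g x) 0) 0)
  (fun x => (M x - w x) ^+ 2) (fun x => k x ^+ 2) (fun x => (g x - w x) ^+ 2)
  ler01 (ltW a20) (ltW a20) (ltW a20) mp (L0X 2 (L0B LM.1 Lw.1)) (L0X 2 mk)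
  (L0X 2 (L0B mg Lw.1)).
rewrite mul1e -/(l2sq mu (fun x => M x - w x)) -/(l2sq mu (fun x => g x - w x)) -/(l2sq mu k).
rewrite (L2_fin (L2B LM Lw)) (L2_fin (L2B Lg Lw)) (L2_fin Lk) -!/(nrm2 mu _) => H.
have {}H : (\int[mu]_x (`|f x| * Num.max (k x - Num.max (g x) 0) 0)%:E +
    (alpha / 2)%:E * (nrm2 mu (fun x => (M x - w x)%R))%:E <=
    (alpha / 2)%:E * (nrm2 mu k)%:E + (alpha / 2)%:E * (nrm2 mu (fun x => (g x - w x)%R))%:E)%E.
  apply: H.
  - by move=> x; rewrite mulr_ge0// le_max lexx orbT.
  - by move=> x; exact: sqr_ge0.
  - by move=> x; exact: sqr_ge0.
  - by move=> x; exact: sqr_ge0.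
  apply: aeS f0 => x fx; rewrite mul1r ger0_norm//.
  have -> : f x = alpha * w x by rewrite /w mulVKf// gt_eqF.
  have w0 : 0 <= w x by rewrite mulr_ge0// invr_ge0 ltW.
  apply: (@le_trans _ _ (alpha * w x * Num.max (k x - g x) 0 + alpha / 2 * (M x - w x) ^+ 2)).
    rewrite lerD2r; apply: ler_wpM2l; first by rewrite mulr_ge0// ltW.
    by apply: le_max2 => //; rewrite lerD2l lerN2 le_max lexx.
  rewrite /M; case: (leP (k x) (g x)) => kg.
    rewrite max_r ?subr_le0// mulr0 add0r lerDr mulr_ge0 ?sqr_ge0//; exact: ltW.
  rewrite max_l ?subr_ge0//; last exact: ltW.
  have : 0 <= alpha / 2 * g x ^+ 2 by rewrite mulr_ge0 ?sqr_ge0//; exact: ltW.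
  by lra.
rewrite -!EFinM -EFinD -leeBrDr// -EFinB in H.
by apply: le_trans H _; rewrite lee_fin; lra.
Qed.

Lemma limn_einf_near (a : nat -> \bar R) (b : nat -> R) (r : R) (N : nat) :
  (forall n, (N <= n)%N -> a n = (b n)%:E) -> b n @[n --> \oo] --> r ->
  limn_einf a = r%:E.
Proof.
move=> ab cb.
have /cvg_limn_einf_sup[-> _] // : a n @[n --> \oo] --> r%:E.
have h : (b n)%:E @[n --> \oo] --> r%:E by apply/cvg_EFin => //; apply: nearW.
by apply: cvg_trans h; apply: near_eq_cvg; exists N => // n /= Nn; rewrite ab.
Qed.

Lemma near_lty (b : nat -> \bar R) (u : \bar R) : b n @[n --> \oo] --> u ->
  (u < +oo)%E -> \forall n \near \oo, (b n < +oo)%E.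
Proof.
case: u => [r| |]// cb _.
- by have /fine_cvgP[fb _] := cb; apply: filterS fb => n; rewrite ltey_eq => ->.
- by have /cvgeNyPle/(_ 0) := cb; apply: filterS => n /le_lt_trans; apply; exact: ltry.
Qed.

Lemma fine_maxe0_cvg (b : nat -> \bar R) (u : \bar R) : b n @[n --> \oo] --> u ->
  (u < +oo)%E -> fine (maxe (b n) 0) @[n --> \oo] --> fine (maxe u 0).
Proof.
case: u => [r| |]// cb _.
- have /fine_cvgP[fb cfb] := cb.
  have h : Num.max (fine (b n)) 0 @[n --> \oo] --> fine (maxe r%:E 0).
    by rewrite -EFin_max /=; apply: cvgn_max => //; exact: cvg_cst.
  apply: cvg_trans h; apply: near_eq_cvg; apply: filterS fb => n /= fn.
  by rewrite -(fineK fn) -EFin_max.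
- apply: cvg_near_cst; have /cvgeNyPle/(_ 0) := cb; apply: filterS => n h.
  by rewrite !max_r// leNye.
Qed.

(** [l] is the positive part of the potential of [f]. The resolvent estimate passes to the limit by
    Fatou, first along the approximants of [f], then as [alpha] tends to 0, where the term
    [alpha / 2 * |k|^2] disappears. *)
Lemma subcritical_weight : subcritical mu E -> exists (f l : X -> R),
  [/\ L0 f, L0 l, (forall x, 0 < f x) & forall k (c : R), L0 k -> (Ee mu E k <= c%:E)%E ->
    (\int[mu]_x (f x * Num.max (k x - l x) 0)%:E <= c%:E)%E].
Proof.
move=> [f [u [mf [f0 [Hr Hl]]]]].
pose al n : R := n.+1%:R^-1.
have al0 n : 0 < al n by rewrite invr_gt0 ltr0n.
have al_cvg : al n @[n --> \oo] --> 0^'+.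
  move=> P [e /= e0 He].
  have [N _ HN] := near_infty_natSinv_lt (PosNum e0).
  exists N => // n /= Nn; apply: He => //=.
  by rewrite sub0r normrN gtr0_norm//; exact: HN.
have /choice[fg Hfg] : forall n, exists p : (nat -> X -> R) * (nat -> X -> R),
    [/\ (forall m, L2 mu (p.1 m)), (forall m, resolvent mu E (al n) (p.1 m) (p.2 m)),
    {ae mu, forall x, (forall m, (0 <= p.1 m x)%R /\ (p.1 m x <= p.1 m.+1 x)%R) /\
       p.1 m x @[m --> \oo] --> (f x)} &
    {ae mu, forall x, (p.2 m x)%:E @[m --> \oo] --> (u (al n) x)}].
  move=> n; have [fn [gn [H1 [H2 [H3 H4]]]]] := Hr _ (al0 n).
  by exists (fn, gn).
pose F n m := (fg n).1 m.
pose G n m x := Num.max ((fg n).2 m x) 0.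
have mG n m : L0 (G n m).
  by apply: L0max; [have [_ /(_ m)[[]]] := Hfg n|exact: L0cst].
(* An iterated liminf is measurable. At almost every point the outer limit is finite, but the inner
   ones may be infinite for small [n], hence the index [N] in [Hae]. *)
pose l x := fine (limn_einf (fun n => limn_einf (fun m => (G n m x)%:E))).
have ml : L0 l.
  apply: measurableT_comp; first exact: fine_measurable.
  apply: measurable_fun_limn_einf => n; apply: measurable_fun_limn_einf => m.
  by apply/measurable_EFinP; exact: mG.
have Hae : {ae mu, forall x, exists N (v : nat -> R), [/\ v n @[n --> \oo] --> l x,
    (forall n, (N <= n)%N -> G n m x @[m --> \oo] --> v n) &
    (forall n, F n m x @[m --> \oo] --> f x)]}.
  have H3 : {ae mu, forall x, forall n, F n m x @[m --> \oo] --> f x}.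
    by apply: ae_foralln => n; have [_ _ + _] := Hfg n; apply: aeS => x [].
  have H4 : {ae mu, forall x, forall n, ((fg n).2 m x)%:E @[m --> \oo] --> (u (al n) x)}.
    by apply: ae_foralln => n; have [_ _ _] := Hfg n.
  apply: aeS3 H3 H4 Hl => x h3 h4 [l' [cl loo]].
  have cu : u (al n) x @[n --> \oo] --> l' .
    exact: (@cvg_comp _ _ _ al (fun a => u a x) _ _ _ al_cvg cl).
  have [N _ HN] : \forall n \near \oo, (u (al n) x < +oo)%E.
    exact: near_lty cu loo.
  pose v n := fine (maxe (u (al n) x) 0).
  have cv : v n @[n --> \oo] --> fine (maxe l' 0) by exact: fine_maxe0_cvg.
  have cG n : (N <= n)%N -> G n m x @[m --> \oo] --> v n.
    move=> Nn; have := fine_maxe0_cvg (h4 n) (HN n Nn).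
    suff -> : (fun m => fine (maxe ((fg n).2 m x)%:E 0)) = (fun m => G n m x) by [].
    by apply/funext => m; rewrite -EFin_max.
  have lE : l x = fine (maxe l' 0).
    rewrite /l (@limn_einf_near _ v _ N _ cv)// => n Nn.
    by apply: (@limn_einf_near _ (fun m => G n m x) _ 0%N) => //; exact: cG.
  by exists N, v; split => //; rewrite lE.
exists f, l; split => // k c mk Ek.
(* Only for [k] in L2 is the error term [alpha / 2 * |k|^2] finite; general [k] follow by Fatou
   along L2 approximants. *)
suff main k' c' : L2 mu k' -> (E k' <= c'%:E)%E ->
    (\int[mu]_x (f x * Num.max (k' x - l x) 0)%:E <= c'%:E)%E.
  apply/lee_addgt0Pr => e e0; have [kn [Lkn Ekn ck]] := Ee_approx sf mk Ek e0.
  have mp h : L0 h -> L0 (fun x => f x * Num.max (h x - l x) 0).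
    move=> mh; apply: L0M => //; apply: L0max; last exact: L0cst.
    exact: L0B.
  have p0 h x : 0 <= f x * Num.max (h x - l x) 0 by rewrite mulr_ge0 ?(ltW (f0 x))// le_max lexx orbT.
  apply: (@fatou_ae _ _ _ mu (fun n x => f x * Num.max (kn n x - l x) 0)) => //.
  - by move=> n; apply: mp; case: (Lkn n).
  - exact: mp.
  - apply: aeS ck => x cx; apply: cvgM; first exact: cvg_cst.
    apply: cvgn_max; last exact: cvg_cst.
    by apply: cvgB => //; exact: cvg_cst.
  - by move=> N; exists N; split => //; rewrite -EFinD; exact: main.
move=> {k c mk Ek} Lk Ek; set k := k' in Lk Ek *; set c := c' in Ek *.
have mk : L0 k by case: Lk.
pose phi n m x := `|F n m x| * Num.max (k x - G n m x) 0.
have mphi n m : L0 (phi n m).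
  apply: L0M; first by apply: L0abs; have [/(_ m)[]] := Hfg n.
  by apply: L0max; [exact: L0B|exact: L0cst].
have phi0 n m x : 0 <= phi n m x by rewrite mulr_ge0// le_max lexx orbT.
pose Psi n x := limn_einf (fun m => (phi n m x)%:E).
have mPsi n : measurable_fun [set: borel X] (Psi n).
  by apply: measurable_fun_limn_einf => m; apply/measurable_EFinP; exact: mphi.
have Psi0 n x : (0 <= Psi n x)%E by apply: (@limn_einf_ge _ _ 0%N) => m _; rewrite lee_fin.
have iPsi n : (\int[mu]_x Psi n x <= (c + al n / 2 * nrm2 mu k)%:E)%E.
  have mE m : measurable_fun [set: borel X] (fun x => (phi n m x)%:E).
    by apply/measurable_EFinP; exact: mphi.
  apply: le_trans (fatou mu measurableT mE _) _; first by move=> m x _; rewrite lee_fin.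
  apply: limn_einf_le => N; exists N; split => //.
  have [H1 H2 H3 _] := Hfg n.
  have F0 : {ae mu, forall x, 0 <= (fg n).1 N x} by apply: aeS H3 => x [/(_ N)[]].
  exact: (resolvent_weight_le (al0 n) (H1 N) F0 (H2 N) Lk Ek).
apply: (@le_trans _ _ (\int[mu]_x limn_einf (Psi ^~ x))%E).
  apply: ae_ge0_le_integral => //.
  - by move=> x _; rewrite lee_fin mulr_ge0 ?(ltW (f0 x))// le_max lexx orbT.
  - apply/measurable_EFinP; apply: L0M => //; apply: L0max; last exact: L0cst.
    exact: L0B.
  - by move=> x _; apply: (@limn_einf_ge _ _ 0%N) => n _.
  - exact: measurable_fun_limn_einf.
  - apply: aeS Hae => x [N [v [cv cG cF]]] _.
    rewrite (@limn_einf_near _ (fun n => f x * Num.max (k x - v n) 0) (f x * Num.max (k x - l x) 0) N)//.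
    - move=> n Nn; apply: (@limn_einf_near _ (fun m => phi n m x) _ 0%N) => //.
      apply: cvgM; first by rewrite -[X in _ --> X]gtr0_norm//; apply: cvg_norm; exact: cF.
      apply: cvgn_max; last exact: cvg_cst.
      by apply: cvgB; [exact: cvg_cst|exact: cG].
    - apply: cvgM; first exact: cvg_cst.
      apply: cvgn_max; last exact: cvg_cst.
      by apply: cvgB => //; exact: cvg_cst.
apply: le_trans (fatou mu measurableT mPsi (fun n x _ => Psi0 n x)) _.
apply/lee_addgt0Pr => e e0; rewrite -EFinD; apply: limn_einf_le => N.
have e1 : 0 < e / (nrm2 mu k + 1) by rewrite divr_gt0// ltr_wpDl ?nrm2_ge0.
have [M _ HM] := near_infty_natSinv_lt (PosNum e1).
exists (maxn N M); split; first exact: leq_maxl.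
apply: le_trans (iPsi _) _; rewrite lee_fin lerD2l.
have := HM (maxn N M) (leq_maxr _ _); rewrite /= ltr_pdivlMr ?ltr_wpDl ?nrm2_ge0//.
rewrite -[(maxn N M).+1%:R^-1]/(al (maxn N M)).
move: (al (maxn N M)) (al0 (maxn N M)) (nrm2_ge0 mu k) => a a00 n0.
have : 0 <= a * nrm2 mu k by rewrite mulr_ge0// ltW.
by lra.
Qed.

(** By Fatou the liminf of [f * (a n - l)^+] is integrable, hence finite almost everywhere; by
    monotonicity it bounds the whole sequence. *)
Lemma bounded_of_Ee_bounded (a : nat -> X -> R) (c : R) : subcritical mu E ->
  (forall n, L0 (a n)) -> (forall n, (Ee mu E (a n) <= c%:E)%E) ->
  {ae mu, forall x, forall n, a n x <= a n.+1 x} ->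
  {ae mu, forall x, exists M, forall n, a n x <= M}.
Proof.
move=> /subcritical_weight[f [l [mf ml f0 H]]] ma Ea mono.
pose phi n x := f x * Num.max (a n x - l x) 0.
have mphi n : L0 (phi n).
  by apply: L0M => //; apply: L0max; [exact: L0B|exact: L0cst].
have phi0 n x : 0 <= phi n x by rewrite mulr_ge0 ?(ltW (f0 x))// le_max lexx orbT.
have mE n : measurable_fun [set: borel X] (fun x => (phi n x)%:E).
  by apply/measurable_EFinP; exact: mphi.
have i0 : (\int[mu]_x limn_einf (fun n => (phi n x)%:E) <= c%:E)%E.
  apply: le_trans (fatou mu measurableT mE _) _; first by move=> m x _; rewrite lee_fin.
  by apply: limn_einf_le => N; exists N; split => //; exact: H.
have pos x : (0 <= limn_einf (fun n => (phi n x)%:E))%E.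
  by apply: (@limn_einf_ge _ _ 0%N) => n _; rewrite lee_fin.
have : mu.-integrable [set: borel X] (fun x => limn_einf (fun n => (phi n x)%:E)).
  apply/integrableP; split; first exact: measurable_fun_limn_einf.
  under eq_integral do rewrite gee0_abs//.
  by apply: le_lt_trans i0 _; exact: ltry.
move=> /(integrable_ae measurableT) fin.
apply: aeS2 fin mono => x /(_ I) finx monox.
pose r := fine (limn_einf (fun n => (phi n x)%:E)).
have nda : nondecreasing_seq (fun n => a n x) by apply/nondecreasing_seqP.
exists (l x + (r + 1) / f x) => n; rewrite -lerBlDl ler_pdivlMr// mulrC.
have : (limn_einf (fun n => (phi n x)%:E) < (r + 1)%:E)%E by rewrite -(fineK finx) lte_fin ltrDl.
move=> /limn_einf_lt_freq/(_ n)[m [nm]]; rewrite lte_fin => /ltW; apply: le_trans.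
rewrite /phi ler_pM2l// le_max lerD2r; apply/orP; left; exact: nda.
Qed.

(** The weight estimate at [2^n * p n], divided by [2^n], makes the integrals of
    [f * (p n - 2^-n * l)^+] summable; [p n] is then squeezed by [phi n / f + 2^-n * l]. *)
Lemma cvg0_of_Ee_bounded (p : nat -> X -> R) : subcritical mu E ->
  (forall n, L0 (p n)) -> (forall n x, 0 <= p n x) ->
  (forall n, (Ee mu E (fun x => 2 ^+ n * p n x)%R <= 1)%E) ->
  {ae mu, forall x, p n x @[n --> \oo] --> (0 : R)}.
Proof.
move=> /subcritical_weight[f [l [mf ml f0 H]]] mp p0 Ep.
pose phi n x := f x * Num.max (p n x - 2^-1 ^+ n * l x) 0.
have mphi n : L0 (phi n).
  by apply: L0M => //; apply: L0max; [apply: L0B => //; exact: L0Z|exact: L0cst].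
have phi0 n x : 0 <= phi n x by rewrite mulr_ge0 ?(ltW (f0 x))// le_max lexx orbT.
have iphi n : (\int[mu]_x (phi n x)%:E <= (1 * 2^-1 ^+ n)%:E)%E.
  have h := H _ 1 (L0Z (2 ^+ n) (mp n)) (Ep n).
  have p2 : 0 < 2 ^+ n :> R by rewrite exprn_gt0.
  have -> : (\int[mu]_x (phi n x)%:E = (2^-1 ^+ n)%:E *
      \int[mu]_x (f x * Num.max (2 ^+ n * p n x - l x) 0)%:E)%E.
    rewrite -ge0_integralZl//.
    - apply: eq_integral => x _; rewrite -EFinM; congr EFin.
      rewrite /phi mulrCA; congr (_ * _); rewrite maxr_pMr ?exprn_ge0// mulr0.
      by rewrite mulrBr mulrA -exprMn mulVf// expr1n mul1r.
    - apply/measurable_EFinP; apply: L0M => //; apply: L0max; last exact: L0cst.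
      by apply: L0B => //; exact: L0Z.
    - by move=> x _; rewrite lee_fin mulr_ge0 ?(ltW (f0 x))// le_max lexx orbT.
  by rewrite mul1r -[leRHS]mule1; apply: lee_wpmul2l.
have := @ae_cvg0_summable _ _ _ mu phi 1 mphi phi0 iphi.
apply: aeS => x cx.
have g0 : (2^-1 : R) ^+ n @[n --> \oo] --> (0 : R).
  by apply: cvg_expr; rewrite ger0_norm// invf_lt1// ltr1n.
apply: (@squeeze_cvgr _ _ _ _ (fun=> 0) (fun n => (f x)^-1 * phi n x + 2^-1 ^+ n * l x)).
- apply: nearW => n; rewrite p0/= /phi mulKf ?gt_eqF//.
  by rewrite -lerBlDr le_max lexx.
- exact: cvg_cst.
- rewrite -[X in _ --> X](_ : (f x)^-1 * 0 + 0 * l x = 0); last by rewrite mulr0 mul0r addr0.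
  by apply: cvgD; apply: cvgM => //; exact: cvg_cst.
Qed.

End Subcritical.

(** * The obstacle problem *)
Section Obstacle.
Context (R : realType) (X : ptopologicalType)
        (mu : {measure set (borel X) -> \bar R}) (E : (X -> R) -> \bar R).
Hypothesis (sf : sigma_finite [set: borel X] mu).
Hypothesis (nE : nopf mu E) (eE : Ee_exists mu E).
Implicit Types f g u v w k : X -> R.

(** Finite approximations of the tail infimum at [j]. Taking minima preserves the obstacle
    constraint, and by submodularity it merely adds up the errors in energy. *)
Fixpoint running_min (g : nat -> X -> R) (j n : nat) : X -> R :=
  if n is n'.+1 then fun x => Num.min (running_min g j n' x) (g (j + n'.+1)%N x) else g j.

Lemma running_min_shift (g : nat -> X -> R) (j n : nat) (x : X) : running_min g j n.+1 x <= running_min g j.+1 n x.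
Proof.
elim: n => [|n IH]; first by rewrite /= addn1 ge_min lexx orbT.
have -> : running_min g j n.+2 x = Num.min (running_min g j n.+1 x) (g (j + n.+2)%N x) by [].
have -> : running_min g j.+1 n.+1 x =
  Num.min (running_min g j.+1 n x) (g (j.+1 + n.+1)%N x) by [].
by rewrite addSnnS; exact: le_min2.
Qed.

(** The maximum of an admissible function with any other is admissible, so its energy is at least
    the infimum [i]. Through submodularity this bounds the minima along a minimizing sequence, and
    at the end it makes [e], whose energy is at most [i], a truncating function. *)
Lemma obstacle_minimizer h (c : R) : subcritical mu E -> L0 h ->
  {ae mu, forall x, 0 <= h x} -> (Ee mu E h <= c%:E)%E ->
  exists e : X -> R, [/\ L0 e, (forall x, 0 <= e x), {ae mu, forall x, h x <= e x},
    (Ee mu E e <= c%:E)%E & forall f (c' : R), L0 f -> (Ee mu E f <= c'%:E)%E ->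
      (Ee mu E (fun x => Num.min (f x) (e x)) <= c'%:E)%E].
Proof.
move=> sub mh h0 Eh.
pose S := [set Ee mu E g | g in [set g | L0 g /\ {ae mu, forall x, h x <= g x}]].
have Sfin : ereal_inf S \is a fin_num.
  rewrite ge0_fin_numE; last by apply: le_ereal_inf_tmp => _ [k _ <-]; exact: Ee_ge0 nE _.
  apply: le_lt_trans (ltry c); apply: le_trans Eh; apply: ereal_inf_lbound.
  by exists h => //; split => //; apply: aeW.
pose i := fine (ereal_inf S).
have iS g : L0 g -> {ae mu, forall x, h x <= g x} -> (i%:E <= Ee mu E g)%E.
  by move=> mg hg; rewrite fineK//; apply: ereal_inf_lbound; exists g.
have pw n : 0 < (2^-1 : R) ^+ n by rewrite exprn_gt0.
have /choice[g Hg] : forall n, exists g, [/\ L0 g, {ae mu, forall x, h x <= g x} &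
    (Ee mu E g <= (i + 2^-1 ^+ n)%:E)%E].
  move=> n; have [_ [g [mg hg] <-] /ltW] := lb_ereal_inf_adherent (pw n) Sfin.
  by rewrite -(fineK Sfin) -EFinD; exists g.
pose A := running_min g.
have mA j n : L0 (A j n).
  elim: n => [|n IH]; first by have [] := Hg j.
  by apply: L0min => //; have [] := Hg (j + n.+1)%N.
have hA j : {ae mu, forall x, forall n, h x <= A j n x}.
  have : {ae mu, forall x, forall n, h x <= g n x}.
    by apply: ae_foralln => n; have [] := Hg n.
  apply: aeS => x hx; elim => [|n IH]; first exact: hx.
  by rewrite /A /= le_min hx andbT.
(* The error is [2^-j + ... + 2^-(j + n)] in closed form, one summand per function in the
   minimum. *)
have EA j n : (Ee mu E (A j n) <= (i + (2 * 2^-1 ^+ j - 2^-1 ^+ (j + n)))%:E)%E.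
  elim: n => [|n IH].
    have [_ _] := Hg j; rewrite addn0 /A /=; congr (_ <= _%:E)%E; ring.
  have [m1 h1 E1] := Hg (j + n.+1)%N.
  have low : (i%:E <= Ee mu E (fun x => Num.max (A j n x) (g (j + n.+1)%N x)))%E.
    by apply: iS; [exact: L0max|apply: aeS h1 => x hx; rewrite le_max hx orbT].
  apply: le_trans (Ee_submod sf nE eE (mA j n) m1 IH E1 low) _.
  by rewrite lee_fin addnS exprS; lra.
pose a j x := fine (limn_einf (fun n => (A j n x)%:E)).
have ma j : L0 (a j).
  apply: measurableT_comp; first exact: fine_measurable.
  by apply: measurable_fun_limn_einf => n; apply/measurable_EFinP; exact: mA.
have cA j : {ae mu, forall x, A j n x @[n --> \oo] --> a j x}.
  apply: aeS (hA j) => x hx; apply: cvgn_fine_limn_einf.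
  apply: nonincreasing_is_cvgn; last by exists (h x) => _ [n _ <-].
  by apply/nonincreasing_seqP => n; rewrite /A /= ge_min lexx.
have Ea j : (Ee mu E (a j) <= (i + 2 * 2^-1 ^+ j)%:E)%E.
  apply: (@Ee_lsc _ _ _ _ sf _ (A j)) => //.
  move=> N; exists N; split => //; apply: le_trans (EA j N) _.
  by rewrite lee_fin lerD2l gerBl ltW.
have ha : {ae mu, forall x, forall j, h x <= a j x}.
  apply: ae_foralln => j; apply: aeS2 (hA j) (cA j) => x hx cx.
  by apply: (cvgr_to_ge cx); apply: nearW.
have amono : {ae mu, forall x, forall j, a j x <= a j.+1 x}.
  apply: ae_foralln => j; apply: aeS2 (cA j) (cA j.+1) => x c1 c2.
  have c1' : A j n.+1 x @[n --> \oo] --> a j x by rewrite (cvg_shiftS (fun n => A j n x)).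
  apply: (ler_cvg_to c1' c2); apply: nearW => n; exact: running_min_shift.
have abnd : {ae mu, forall x, exists M, forall j, a j x <= M}.
  apply: (bounded_of_Ee_bounded sf nE (c := i + 2) sub ma _ amono) => j.
  apply: le_trans (Ea j) _; rewrite lee_fin lerD2l ger_pMr//.
  by rewrite exprn_ile1// invf_le1// ler1n.
pose e' x := fine (limn_einf (fun n => (a n x)%:E)).
have me' : L0 e'.
  apply: measurableT_comp; first exact: fine_measurable.
  by apply: measurable_fun_limn_einf => n; apply/measurable_EFinP; exact: ma.
have ca : {ae mu, forall x, a n x @[n --> \oo] --> e' x}.
  apply: aeS2 amono abnd => x mx [M HM]; apply: cvgn_fine_limn_einf.
  apply: nondecreasing_is_cvgn; last by exists M => _ [n _ <-].
  exact/nondecreasing_seqP.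
have he' : {ae mu, forall x, h x <= e' x}.
  by apply: aeS2 ha ca => x hx cx; apply: (cvgr_to_ge cx); apply: nearW.
have Ee' : (Ee mu E e' <= i%:E)%E.
  apply/lee_addgt0Pr => d d0; rewrite -EFinD.
  apply: (@Ee_lsc _ _ _ _ sf _ a) => // N.
  have d20 : 0 < d / 2 by lra.
  have : 2^-1 ^+ n @[n --> \oo] --> (0 : R).
    by apply: cvg_expr; rewrite ger0_norm// invf_lt1// ltr1n.
  move=> /cvgrPdist_le/(_ _ d20)[M _ HM].
  exists (maxn N M); split; first exact: leq_maxl.
  apply: le_trans (Ea _) _; rewrite lee_fin lerD2l.
  have := HM (maxn N M) (leq_maxr _ _); rewrite /= sub0r normrN ger0_norm ?exprn_ge0//.
  by lra.
(* Nonnegativity is demanded at every point; the change concerns a null set because [h >= 0] almost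
   everywhere. *)
pose e x := Num.max (e' x) 0.
have me : L0 e by apply: L0max => //; exact: L0cst.
have Ee_e : (Ee mu E e <= i%:E)%E.
  apply: (Ee_ae sf me' me _ Ee'); apply: aeS2 h0 he' => x x0 hx.
  by rewrite /e max_l//; exact: le_trans hx.
have he : {ae mu, forall x, h x <= e x} by apply: aeS he' => x hx; rewrite /e le_max hx.
exists e; split => //.
- by move=> x; rewrite /e le_max lexx orbT.
- apply: le_trans Ee_e _; apply: le_trans Eh; apply: iS => //; exact: aeW.
- move=> f c' mf Ef.
  have low : (i%:E <= Ee mu E (fun x => Num.max (f x) (e x)))%E.
    by apply: iS; [exact: L0max|apply: aeS he => x hx; rewrite le_max hx orbT].
  by apply: le_trans (Ee_submod sf nE eE mf me Ef Ee_e low) _; rewrite lee_fin; lra.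
Qed.

End Obstacle.

(** * The Hahn-Banach theorem on a subspace *)
Section HahnBanach.
Context (R : realType) (X : Type) (S : (X -> R) -> Prop).
Hypothesis (S0 : S (fun=> 0)).
Hypothesis (SD : forall f g, S f -> S g -> S (fun x => f x + g x)).
Hypothesis (SZ : forall (t : R) f, S f -> S (fun x => t * f x)).

(** Homogeneity is asked for as an inequality, which is what infima deliver; equality follows by
    scaling back. *)
Definition sublinear (p : (X -> R) -> R) : Prop :=
  [/\ p (fun=> 0) = 0,
      (forall f g, S f -> S g -> p (fun x => f x + g x) <= p f + p g) &
      (forall (t : R) f, 0 < t -> S f -> p (fun x => t * f x) <= t * p f)].

Lemma SN f : S f -> S (fun x => - f x).
Proof. by move=> Sf; have := SZ (-1) Sf; under eq_fun do rewrite mulN1r. Qed.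

Lemma sublinear_opp p f : sublinear p -> S f -> - p (fun x => - f x) <= p f.
Proof.
move=> [p0 pD _] Sf; rewrite lerNl -subr_ge0 opprK -p0.
have := pD _ _ (SN Sf) Sf.
by under eq_fun do rewrite addNr.
Qed.

Lemma sublinear_posZ p (t : R) f : sublinear p -> 0 < t -> S f ->
  p (fun x => t * f x) = t * p f.
Proof.
move=> [_ _ pZ] t0 Sf; apply/eqP; rewrite eq_le pZ//=.
have ti : 0 < t^-1 by rewrite invr_gt0.
have := pZ _ _ ti (SZ t Sf).
under eq_fun do rewrite mulKf ?gt_eqF//.
by rewrite ler_pdivlMl.
Qed.

(** [p f] is the infimum of [q (f + t * c) - t * d] over [t >= 0] and [c] in [C]. A linear
    functional below [p] is at most [-d] on [-C]. This serves the separation of a convex set and,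
    with [C] a single point, the additivity of a minimal sublinear functional. *)
Lemma sublinear_cone q (C : (X -> R) -> Prop) (d : R) c0 : sublinear q -> C c0 ->
  (forall c, C c -> S c /\ d <= q c) ->
  (forall (s t : R) c c', 0 <= s -> 0 <= t -> 0 < s + t -> C c -> C c' ->
    exists2 c'', C c'' & forall x, (s + t) * c'' x = s * c x + t * c' x) ->
  exists p, [/\ sublinear p, (forall f, S f -> p f <= q f) &
    (forall f c, S f -> C c -> p f <= q (fun x => f x + c x) - d)].
Proof.
move=> sq Cc0 HC Hconv; have [q0 qD qZ] := sq.
pose D f := [set r | exists t c, [/\ 0 <= t, C c & r = q (fun x => f x + t * c x) - t * d]].
pose p f := inf (D f).
(* The infimum is finite since [t * d <= q (t * c) <= q (f + t * c) + q (- f)]. *)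
have lbD f : S f -> lbound (D f) (- q (fun x => - f x)).
  move=> Sf _ [t [c [t0 Cc ->]]]; have [Sc dc] := HC c Cc.
  have h : q (fun x => t * c x) <= q (fun x => f x + t * c x) + q (fun x => - f x).
    have := qD _ _ (SD Sf (SZ t Sc)) (SN Sf).
    suff -> : (fun x => f x + t * c x - f x) = (fun x => t * c x) by [].
    by apply/funext => x; ring.
  have h2 : t * d <= q (fun x => t * c x).
    move: t0; rewrite le_eqVlt => /orP[/eqP <-|t0].
      by rewrite mul0r; under eq_fun do rewrite mul0r; rewrite q0.
    by rewrite (sublinear_posZ sq t0 Sc) ler_pM2l.
  by lra.
have nD f : D f !=set0 by exists (q (fun x => f x + 0 * c0 x) - 0 * d), 0, c0.
have hi f : S f -> has_inf (D f) by move=> Sf; split; [exact: nD|exists (- q (fun x => - f x)); exact: lbD].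
have pD f (t : R) c : S f -> 0 <= t -> C c -> p f <= q (fun x => f x + t * c x) - t * d.
  by move=> Sf t0 Cc; apply: ge_inf; [exact: (hi f Sf).2|exists t, c].
have pq f : S f -> p f <= q f.
  move=> Sf; have := pD f 0 c0 Sf (lexx 0) Cc0.
  by rewrite mul0r subr0; under eq_fun do rewrite mul0r addr0.
have approx f (e : R) : S f -> 0 < e -> exists t c, [/\ 0 <= t, C c &
    q (fun x => f x + t * c x) - t * d <= p f + e].
  move=> Sf e0; have [_ [t [c [t0 Cc ->]]] /ltW h] := inf_adherent e0 (hi f Sf).
  by exists t, c.
exists p; split => //; last first.
  move=> f c Sf Cc; have := pD f 1 c Sf ler01 Cc.
  by rewrite mul1r; under eq_fun do rewrite mul1r.
split.
- apply/eqP; rewrite eq_le; apply/andP; split; first by apply: le_trans (pq _ S0) _; rewrite q0.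
  apply: lb_le_inf; first exact: nD.
  by have := lbD _ S0; under [X in lbound _ (- q X)]eq_fun do rewrite oppr0; rewrite q0 oppr0.
- move=> f g Sf Sg; apply/ler_addgt0Pr => e e0.
  have e2 : 0 < e / 2 by lra.
  have [t1 [c1 [t10 C1 h1]]] := approx f _ Sf e2.
  have [t2 [c2 [t20 C2 h2]]] := approx g _ Sg e2.
  have [S1 _] := HC _ C1; have [S2 _] := HC _ C2.
  have [c [Cc cE]] : exists c, C c /\ forall x, (t1 + t2) * c x = t1 * c1 x + t2 * c2 x.
    have := addr_ge0 t10 t20; rewrite le_eqVlt => /orP[/eqP t120|tp].
      exists c0; split => // x.
      have -> : t1 = 0 by lra.
      have -> : t2 = 0 by lra.
      by rewrite addr0 !mul0r addr0.
    by have [c Cc cE] := Hconv t1 t2 c1 c2 t10 t20 tp C1 C2; exists c.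
  apply: le_trans (pD _ (t1 + t2) c (SD Sf Sg) (addr_ge0 t10 t20) Cc) _.
  have := qD _ _ (SD Sf (SZ t1 S1)) (SD Sg (SZ t2 S2)).
  have -> : (fun x => f x + t1 * c1 x + (g x + t2 * c2 x)) =
            (fun x => f x + g x + (t1 + t2) * c x).
    by apply/funext => x; rewrite cE; ring.
  by lra.
- move=> t f t0 Sf; apply/ler_addgt0Pr => e e0.
  have et : 0 < e / t by rewrite divr_gt0.
  have [s [c [s0 Cc h]]] := approx f _ Sf et.
  have [Sc _] := HC _ Cc.
  have ts : 0 <= t * s by rewrite mulr_ge0// ltW.
  apply: le_trans (pD _ (t * s) c (SZ t Sf) ts Cc) _.
  have -> : (fun x => t * f x + t * s * c x) = (fun x => t * (f x + s * c x)).
    by apply/funext => x; ring.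
  rewrite (sublinear_posZ sq t0 (SD Sf (SZ s Sc))).
  have := ler_wpM2l (ltW t0) h.
  have -> : t * (p f + e / t) = t * p f + e by field; rewrite gt_eqF.
  by lra.
Qed.

(** Instead of extending from subspaces, Zorn's lemma gives a minimal sublinear functional below
    [p], a chain being bounded by its pointwise infimum. Minimality forces linearity. *)
Lemma dominated_linear p : sublinear p ->
  exists phi, (forall f, S f -> phi f <= p f) /\
    (forall (a b : R) f g, S f -> S g ->
       phi (fun x => a * f x + b * g x) = a * phi f + b * phi g).
Proof.
move=> sp.
pose T := {q : (X -> R) -> R | sublinear q /\ forall f, S f -> q f <= p f}.
pose t0 : T := exist _ p (conj sp (fun f _ => lexx (p f))).
(* The order is reversed: a maximal element is a minimal functional. *)
pose le (a b : T) := `[< forall f, S f -> sval b f <= sval a f >].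
have [||A totA|q Hq] := @ZL_preorder T t0 le.
- by move=> a; apply/asboolP.
- move=> a b c /asboolP ab /asboolP bc; apply/asboolP => f Sf.
  exact: le_trans (bc f Sf) (ab f Sf).
- have [->|/set0P[a0 Aa0]] := eqVneq A set0; first by exists t0.
  pose D f := [set sval a f | a in A].
  pose r f := inf (D f).
  have hi f : S f -> has_inf (D f).
    move=> Sf; split; first by exists (sval a0 f), a0.
    exists (- p (fun x => - f x)) => _ [a _ <-].
    have [sa ap] := svalP a; apply: le_trans (sublinear_opp sa Sf).
    by rewrite lerN2; apply: ap; exact: SN.
  have rle a f : A a -> S f -> r f <= sval a f.
    by move=> Aa Sf; apply: ge_inf; [exact: (hi f Sf).2|exists a].
  have approx f (e : R) : S f -> 0 < e -> exists2 a, A a & sval a f <= r f + e.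
    by move=> Sf e0; have [_ [a Aa <-] /ltW] := inf_adherent e0 (hi f Sf); exists a.
  have sr : sublinear r.
    split.
    - apply/eqP; rewrite eq_le; apply/andP; split.
        by have [[a00 _ _] _] := svalP a0; apply: le_trans (rle a0 _ Aa0 S0) _; rewrite a00.
      apply: lb_le_inf; first by exists (sval a0 (fun=> 0)), a0.
      by move=> _ [a _ <-]; have [[-> _ _] _] := svalP a.
    - move=> f g Sf Sg; apply/ler_addgt0Pr => e e0.
      have e2 : 0 < e / 2 by lra.
      have [a Aa ha] := approx f _ Sf e2; have [b Ab hb] := approx g _ Sg e2.
      have [/asboolP ab|/asboolP ba] := totA a b Aa Ab.
        have [[_ bD _] _] := svalP b.
        apply: le_trans (rle b _ Ab (SD Sf Sg)) _; apply: le_trans (bD _ _ Sf Sg) _.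
        by have := ab f Sf; lra.
      have [[_ aD _] _] := svalP a.
      apply: le_trans (rle a _ Aa (SD Sf Sg)) _; apply: le_trans (aD _ _ Sf Sg) _.
      by have := ba g Sg; lra.
    - move=> t f tp Sf; apply/ler_addgt0Pr => e e0.
      have et : 0 < e / t by rewrite divr_gt0.
      have [a Aa ha] := approx f _ Sf et.
      have [[_ _ aZ] _] := svalP a.
      apply: le_trans (rle a _ Aa (SZ t Sf)) _; apply: le_trans (aZ _ _ tp Sf) _.
      have := ler_wpM2l (ltW tp) ha; rewrite mulrDr [t * (e / t)]mulrC divfK ?gt_eqF//.
  have rp f : S f -> r f <= p f.
    by move=> Sf; apply: le_trans (rle a0 f Aa0 Sf) _; have [_] := svalP a0; exact.
  by exists (exist _ r (conj sr rp)) => a Aa; apply/asboolP => f Sf; exact: rle.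
have [sq qp] := svalP q; have [q0 qD _] := sq.
have add f g : S f -> S g -> sval q (fun x => f x + g x) = sval q f + sval q g.
  move=> Sf Sg; apply/eqP; rewrite eq_le qD//=.
  (* The functional [r] lies below the minimal [q], so [q f <= r f <= q (f + g) - q g]. *)
  have [||r [sr rq rg]] := @sublinear_cone (sval q) (fun c => c = g) (sval q g) g sq erefl.
  - by move=> c ->.
  - by move=> s t c c' _ _ _ -> ->; exists g => // x; rewrite mulrDl.
  have rp h : S h -> r h <= p h by move=> Sh; apply: le_trans (rq h Sh) (qp h Sh).
  have /asboolP/(_ f Sf) : le (exist _ r (conj sr rp)) q.
    by apply: Hq; apply/asboolP => h Sh; exact: rq.
  by have := rg f g Sf erefl => /= h1 h2; lra.
have opp f : S f -> sval q (fun x => - f x) = - sval q f.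
  move=> Sf; have := add _ _ Sf (SN Sf).
  have -> : (fun x => f x - f x) = (fun=> 0) by apply/funext => x; rewrite subrr.
  by rewrite q0 => h; lra.
have hom (t : R) f : S f -> sval q (fun x => t * f x) = t * sval q f.
  move=> Sf; have [tn|tp|->] := ltgtP t 0.
  - have tn' : 0 < - t by lra.
    have := sublinear_posZ sq tn' Sf.
    have -> : (fun x => - t * f x) = (fun x => - (t * f x)) by apply/funext => x; ring.
    by rewrite opp; [lra|exact: SZ].
  - exact: sublinear_posZ.
  - have -> : (fun x => 0 * f x) = (fun=> 0) by apply/funext => x; rewrite mul0r.
    by rewrite q0 mul0r.
exists (sval q); split => // a b f g Sf Sg.
by rewrite add ?hom//; exact: SZ.
Qed.

End HahnBanach.

(** * Luxemburg norms and the Mazur lemma *)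
Section Mazur.
Context (R : realType) (X : ptopologicalType)
        (mu : {measure set (borel X) -> \bar R}) (E : (X -> R) -> \bar R).
Hypothesis (sf : sigma_finite [set: borel X] mu).
Hypothesis (nE : nopf mu E) (eE : Ee_exists mu E) (D2 : Delta2 mu E).
Implicit Types f g u v w : X -> R.

Lemma ratio_itv01 (a b : R) : 0 <= a -> a <= b -> 0 < b -> 0 <= a / b <= 1.
Proof.
move=> a0 ab b0; rewrite divr_ge0//=; last exact: ltW.
by rewrite ler_pdivrMr// mul1r.
Qed.

Lemma Ee_Delta2 : exists2 K : R, 1 <= K & forall f (c : R), L0 f ->
  (Ee mu E f <= c%:E)%E -> (Ee mu E (fun x => 2 * f x)%R <= (K * c)%:E)%E.
Proof.
case: D2 => K0 HK0; pose K := Num.max K0 1.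
exists K; first by rewrite le_max lexx orbT.
apply: (Delta2_Ee sf); first by rewrite le_max ler01 orbT.
move=> f Lf; apply: le_trans (HK0 f Lf) _.
apply: lee_wpmul2r; first exact: (E_ge0 nE).
by rewrite lee_fin le_max lexx.
Qed.

Lemma Ee_Delta2X (n : nat) : exists2 K : R, 1 <= K & forall f (c : R), L0 f ->
  (Ee mu E f <= c%:E)%E -> (Ee mu E (fun x => 2 ^+ n * f x)%R <= (K * c)%:E)%E.
Proof.
have [K K1 HK] := Ee_Delta2.
exists (K ^+ n); first exact: exprn_ege1.
move=> f c mf Ef; elim: n => [|n IH].
  by rewrite mul1r; under eq_fun do rewrite expr0 mul1r.
rewrite [K ^+ n.+1]exprS -mulrA.
have := HK _ _ (L0Z _ mf) IH.
by under eq_fun do rewrite mulrA -exprS.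
Qed.

(** Iterated doubling exceeds [|t|], convexity at 0 comes back down to [|t|], and evenness handles
    the sign. *)
Lemma Ee_scale_fin (t : R) f : L0 f -> (Ee mu E f < +oo)%E ->
  (Ee mu E (fun x => t * f x)%R < +oo)%E.
Proof.
move=> mf Ef.
have Efin : Ee mu E f \is a fin_num by rewrite ge0_fin_numE// (Ee_ge0 nE).
have [K K1 HK] := Ee_Delta2X (Num.truncn `|t|).+1.
pose n := (Num.truncn `|t|).+1.
have tn : `|t| <= 2 ^+ n.
  apply: le_trans (ltW (truncnS_gt _)) _.
  by rewrite -natrX ler_nat ltnW// ltn_expl.
have p2 : 0 < 2 ^+ n :> R by rewrite exprn_gt0.
have Ef' : (Ee mu E f <= (fine (Ee mu E f))%:E)%E by rewrite fineK.
have h := HK f _ mf Ef'.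
have pos s : 0 <= s <= 2 ^+ n -> (Ee mu E (fun x => s * f x)%R < +oo)%E.
  move=> /andP[s0 s1].
  have s01 : 0 <= s / 2 ^+ n <= 1 by exact: ratio_itv01.
  have := Ee_scale sf nE eE (L0Z _ mf) s01 h.
  under eq_fun do rewrite mulrA divfK ?gt_eqF//.
  by move=> /le_lt_trans; apply; exact: ltry.
have [t0|t0] := leP 0 t; first by apply: pos; rewrite t0/= -[t]ger0_norm.
have nt : 0 <= - t <= 2 ^+ n by rewrite -ltr0_norm// normr_ge0.
have := pos _ nt; have mt : L0 (fun x => - t * f x) by exact: L0Z.
rewrite -ge0_fin_numE ?(Ee_ge0 nE)// => fin.
have := Ee_opp sf nE mt (c := fine (Ee mu E (fun x => - t * f x))).
rewrite fineK// lexx => /(_ isT); under eq_fun do rewrite mulNr opprK.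
by move=> /le_lt_trans; apply; rewrite -ge0_fin_numE// (Ee_ge0 nE).
Qed.

Lemma Ee_add_fin f g : L0 f -> L0 g -> (Ee mu E f < +oo)%E -> (Ee mu E g < +oo)%E ->
  (Ee mu E (fun x => f x + g x)%R < +oo)%E.
Proof.
move=> mf mg Ef Eg.
have Ef2 := Ee_scale_fin 2 mf Ef; have Eg2 := Ee_scale_fin 2 mg Eg.
have t01 : 0 <= (2^-1 : R) <= 1 by apply/andP; split; lra.
have := @Ee_conv _ _ _ _ sf nE _ _ (fine (Ee mu E (fun x => 2 * f x)))
  (fine (Ee mu E (fun x => 2 * g x))) 2^-1 (L0Z 2 mf) (L0Z 2 mg) t01.
rewrite !fineK ?ge0_fin_numE ?(Ee_ge0 nE)// !lexx => /(_ isT isT).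
have -> : (fun x => 2^-1 * (2 * f x) + (1 - 2^-1) * (2 * g x)) = (fun x => f x + g x).
  by apply/funext => x; field.
by move=> /le_lt_trans; apply; exact: ltry.
Qed.

(** Generic in [F] and [dom] in order to serve both modular spaces, that of [E] on L2 and that of
    [Ee] on L0. Convexity at 0 gives linear decay. *)
Lemma modular_of_fin (F : (X -> R) -> \bar R) (dom : (X -> R) -> Prop) f :
  dom f -> L0 f -> (Ee mu E f < +oo)%E -> (forall t : R, F (fun x => t * f x) = Ee mu E (fun x => t * f x)) ->
  modular F dom f.
Proof.
move=> df mf Ef FE; split => //.
have Efin : Ee mu E f \is a fin_num by rewrite ge0_fin_numE// (Ee_ge0 nE).
have Ef' : (Ee mu E f <= (fine (Ee mu E f))%:E)%E by rewrite fineK.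
have lim : (t * fine (Ee mu E f))%:E @[t --> 0^'+] --> 0%E.
  apply: cvg_EFin; first exact: nearW.
  have h : t * fine (Ee mu E f) @[t --> 0^'+] --> 0 * fine (Ee mu E f).
    apply: cvgM; last exact: cvg_cst.
    by apply: cvg_at_right_filter; exact: cvg_id.
  by rewrite mul0r in h.
apply: (squeeze_cvge _ (cvg_cst 0%E) lim).
near=> t; rewrite FE (Ee_ge0 nE)/=.
apply: Ee_scale => //; apply/andP; split; first by near: t; exact: nbhs_right_ge.
by near: t; exact: nbhs_right_le.
Unshelve. all: by end_near. Qed.

Lemma fin_of_modular (F : (X -> R) -> \bar R) (dom : (X -> R) -> Prop) f :
  L0 f -> (forall t : R, F (fun x => t * f x) = Ee mu E (fun x => t * f x)) ->
  modular F dom f -> (Ee mu E f < +oo)%E.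
Proof.
move=> mf FE [_ cv].
have : \forall t \near 0^'+, 0 < t /\ (F (fun x => t * f x)%R < +oo)%E.
  apply: filterI; first exact: nbhs_right_gt.
  have /fine_cvgP[+ _] := cv; apply: filterS => t; by rewrite ltey_eq => ->.
move=> /filter_ex[t [t0]]; rewrite FE => /(Ee_scale_fin t^-1 (L0Z t mf)).
by under eq_fun do rewrite mulKf ?gt_eqF//.
Qed.

Lemma MEP f : ME mu E f <-> L2 mu f /\ (Ee mu E f < +oo)%E.
Proof.
split => [m|[Lf Ef]].
  have [Lf _] := m; split => //; apply: (fin_of_modular Lf.1 _ m) => t.
  by rewrite eE//; exact: L2Z.
apply: modular_of_fin => //; first exact: Lf.1.
by move=> t; rewrite eE//; exact: L2Z.
Qed.

Lemma MEeP f : MEe mu E f <-> L0 f /\ (Ee mu E f < +oo)%E.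
Proof.
split => [m|[mf Ef]]; last exact: modular_of_fin.
by have [mf _] := m; split => //; exact: (fin_of_modular mf _ m).
Qed.

Lemma normLeE f : L2 mu f -> normL E f = normLe mu E f.
Proof.
move=> Lf; rewrite /normL /normLe /luxemburg; congr ereal_inf.
apply/seteqP; split => _ [l [l0 h] <-]; exists l => //; split => //.
  by rewrite eE//; exact: L2Z.
by rewrite -eE//; exact: L2Z.
Qed.

Lemma normLe_le (l : R) f : 0 < l -> (Ee mu E (fun x => l^-1 * f x)%R <= 1)%E ->
  (normLe mu E f <= l%:E)%E.
Proof. by move=> l0 h; apply: ereal_inf_lbound; exists l. Qed.

Lemma normLe_lt (l : R) f : L0 f -> (normLe mu E f < l%:E)%E ->
  (Ee mu E (fun x => l^-1 * f x)%R <= 1)%E.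
Proof.
move=> mf /ereal_inf_lt[_ [l' [l'0 h] <-]]; rewrite lte_fin => ll.
have l0 : 0 < l by exact: lt_trans ll.
have t01 : 0 <= l' / l <= 1 by apply: ratio_itv01 => //; exact: ltW.
have := Ee_scale sf nE eE (L0Z _ mf) t01 h.
have -> : (fun x => l' / l * (l'^-1 * f x)) = (fun x => l^-1 * f x).
  by apply/funext => x; field; rewrite !gt_eqF.
move=> /le_trans; apply; rewrite lee_fin mulr1; by case/andP: t01.
Qed.

Lemma normLe_ge0 f : (0 <= normLe mu E f)%E.
Proof. by apply: le_ereal_inf_tmp => _ [l [l0 _] <-]; rewrite lee_fin ltW. Qed.

(** Convexity at 0 with the factor [c^-1], which is why [c] must be at least 1. *)
Lemma normLe_bound f (c : R) : L0 f -> 1 <= c -> (Ee mu E f <= c%:E)%E ->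
  (normLe mu E f <= c%:E)%E.
Proof.
move=> mf c1 Ef; have c0 : 0 < c by lra.
apply: normLe_le => //.
have t01 : 0 <= c^-1 <= 1 by rewrite invr_ge0 ltW//= invf_le1.
apply: le_trans (Ee_scale sf nE eE mf t01 Ef) _.
by rewrite mulVf// gt_eqF.
Qed.

Lemma normLe_fin f : L0 f -> (Ee mu E f < +oo)%E -> normLe mu E f \is a fin_num.
Proof.
move=> mf Ef; rewrite ge0_fin_numE ?normLe_ge0//.
have Efin : Ee mu E f \is a fin_num by rewrite ge0_fin_numE// (Ee_ge0 nE).
have h : (Ee mu E f <= (Num.max 1 (fine (Ee mu E f)))%:E)%E.
  by rewrite -[X in (X <= _)%E]fineK// lee_fin le_max lexx orbT.
apply: le_lt_trans (normLe_bound mf _ h) _; last exact: ltry.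
by rewrite le_max lexx.
Qed.

(** Combinations are finite, so that a property attached to single terms survives in each element.
    The index [m] provides hulls of tails, which inherit almost everywhere limits. *)
Inductive conv_hull (f_ : nat -> X -> R) (m : nat) : (X -> R) -> Prop :=
| conv_hull_pt k : (m <= k)%N -> conv_hull f_ m (f_ k)
| conv_hull_comb (t : R) g g' : 0 <= t <= 1 -> conv_hull f_ m g -> conv_hull f_ m g' ->
    conv_hull f_ m (fun x => t * g x + (1 - t) * g' x).

Lemma conv_hull_closed_ind (P : (X -> R) -> Prop) (f_ : nat -> X -> R) (m : nat) (c : X -> R) :
  (forall k, (m <= k)%N -> P (f_ k)) ->
  (forall (t : R) g g', 0 <= t <= 1 -> P g -> P g' -> P (fun x => t * g x + (1 - t) * g' x)) ->
  conv_hull f_ m c -> P c.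
Proof. by move=> Hpt Hc; elim => // t g g' t01 _ Pg _ Pg'; exact: Hc. Qed.

Lemma conv_hull_cvg (f_ : nat -> X -> R) (c : nat -> X -> R) f x : (forall m, conv_hull f_ m (c m)) ->
  f_ n x @[n --> \oo] --> f x -> c n x @[n --> \oo] --> f x.
Proof.
move=> Hc /cvgrPdist_le cf; apply/cvgrPdist_le => e e0.
have [N _ HN] := cf e e0; exists N => // n /= Nn.
apply: (conv_hull_closed_ind (P := fun g => `|f x - g x| <= e) _ _ (Hc n)).
  by move=> k nk; apply: HN; exact: leq_trans nk.
move=> t g g' /andP[t0 t1] h1 h2.
have -> : f x - (t * g x + (1 - t) * g' x) = t * (f x - g x) + (1 - t) * (f x - g' x) by ring.
apply: le_trans (ler_normD _ _) _; rewrite !normrM ger0_norm// [`|1 - t|]ger0_norm ?subr_ge0//.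
have -> : e = t * e + (1 - t) * e by ring.
by apply: lerD; apply: ler_wpM2l => //; rewrite subr_ge0.
Qed.

Definition ME' f := L2 mu f /\ (Ee mu E f < +oo)%E.

Lemma ME'D f g : ME' f -> ME' g -> ME' (fun x => f x + g x).
Proof.
move=> [Lf Ef] [Lg Eg]; split; first exact: L2D.
by apply: Ee_add_fin => //; [exact: Lf.1|exact: Lg.1].
Qed.

Lemma ME'Z (t : R) f : ME' f -> ME' (fun x => t * f x).
Proof. by move=> [Lf Ef]; split; [exact: L2Z|apply: Ee_scale_fin => //; exact: Lf.1]. Qed.

Lemma ME'0 : ME' (fun=> 0).
Proof. by split; [exact: L2_0|rewrite (Ee0 nE eE) ltry]. Qed.

Let q f := fine (normLe mu E f).

Lemma q_lt f (l : R) : ME' f -> q f < l -> (Ee mu E (fun x => l^-1 * f x)%R <= 1)%E.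
Proof.
move=> [Lf Ef] ql; apply: normLe_lt; first exact: Lf.1.
by rewrite -(fineK (normLe_fin Lf.1 Ef)) lte_fin.
Qed.

Lemma q_le f (l : R) : ME' f -> 0 < l -> (Ee mu E (fun x => l^-1 * f x)%R <= 1)%E -> q f <= l.
Proof.
move=> [Lf Ef] l0 h; rewrite -lee_fin fineK ?(normLe_fin Lf.1)//; exact: normLe_le.
Qed.

Lemma q_ge0 f : 0 <= q f. Proof. by rewrite fine_ge0// normLe_ge0. Qed.

Lemma sublinear_q : sublinear ME' q.
Proof.
split.
- apply/eqP; rewrite eq_le q_ge0 andbT; apply/ler_addgt0Pr => e e0; rewrite add0r.
  apply: q_le => //; first exact: ME'0.
  by under eq_fun do rewrite mulr0; rewrite (Ee0 nE eE).
- move=> f g Mf Mg.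
  have step (a b : R) : q f < a -> q g < b -> q (fun x => f x + g x) <= a + b.
    move=> qa qb.
    have a0 : 0 < a := le_lt_trans (q_ge0 f) qa.
    have b0 : 0 < b := le_lt_trans (q_ge0 g) qb.
    have ab0 := addr_gt0 a0 b0.
    apply: q_le => //; first exact: ME'D.
    have t01 : 0 <= a / (a + b) <= 1.
      by apply: ratio_itv01 => //; [exact: ltW|rewrite lerDl ltW].
    have := Ee_conv sf nE (L0Z a^-1 Mf.1.1) (L0Z b^-1 Mg.1.1) t01 (q_lt Mf qa) (q_lt Mg qb).
    have -> : (fun x => a / (a + b) * (a^-1 * f x) + (1 - a / (a + b)) * (b^-1 * g x)) =
              (fun x => (a + b)^-1 * (f x + g x)).
      by apply/funext => x; field; rewrite !gt_eqF.
    by have -> : a / (a + b) * 1 + (1 - a / (a + b)) * 1 = 1 by ring.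
  apply/ler_addgt0Pr => e e0; have e2 : 0 < e / 2 by rewrite divr_gt0.
  have := step (q f + e / 2) (q g + e / 2); rewrite addrACA -splitr; apply.
    by rewrite ltrDl.
  by rewrite ltrDl.
- move=> t f t0 Mf; apply/ler_addgt0Pr => e e0.
  have et : 0 < e / t by rewrite divr_gt0.
  have qf0 := q_ge0 f.
  have lt : q f < q f + e / t by lra.
  have l0 : 0 < q f + e / t by lra.
  have -> : t * q f + e = t * (q f + e / t) by field; rewrite gt_eqF.
  apply: q_le; [exact: ME'Z|exact: mulr_gt0|].
  have := q_lt Mf lt; congr (Ee _ _ _ <= _)%E; apply/funext => x.
  have := gt_eqF l0; move: (q f + e / t) => l lne.
  by field; rewrite lne gt_eqF.
Qed.

Lemma conv_hull_ME' (f_ : nat -> X -> R) (m : nat) (c : X -> R) : (forall k, ME' (f_ k)) -> conv_hull f_ m c -> ME' c.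
Proof.
move=> Mf; apply: conv_hull_closed_ind => // t g g' _ Mg Mg'.
by apply: ME'D; exact: ME'Z.
Qed.

Lemma fmap_ultra (T V : Type) (f : T -> V) (U : set_system T) :
  UltraFilter U -> UltraFilter (f @ U).
Proof.
move=> UU; split; first exact: fmap_proper_filter.
move=> G PG sub; apply/seteqP; split => // A GA.
have [//|nA] := in_ultra_setVsetC (f @^-1` A) UU.
have GnA : G (~` A) by apply: sub.
by have /filter_ex[? []] : G (A `&` ~` A) by exact: filterI.
Qed.

(** Density in the bidual provides only some [y] near the ultrafilter limit. Hahn-Banach brings
    every tail hull within [e / 4] of [y]; elements of later and later hulls converge to [f] almost
    everywhere, so lower semicontinuity puts [f] within [e / 4] of [y] as well. *)
Lemma mazur (f_ : nat -> X -> R) f (c e : R) : reflexive_form mu E ->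
  (forall n, L2 mu (f_ n)) -> (forall n, (Ee mu E (f_ n) <= c%:E)%E) -> L0 f ->
  {ae mu, forall x, f_ n x @[n --> \oo] --> f x} -> 0 < e ->
  exists2 g, conv_hull f_ 0 g & (normLe mu E (fun x => f x - g x)%R < e%:E)%E.
Proof.
move=> refl Lf_ Ef_ mf cf e0.
have Mf_ n : ME' (f_ n) by split => //; apply: le_lt_trans (Ef_ n) (ltry _).
pose B := Num.max 1 c.
have B1 : 1 <= B by rewrite le_max lexx.
have nB n : (normLe mu E (f_ n) <= B%:E)%E.
  apply: normLe_bound => //; first exact: (Lf_ n).1.
  by apply: le_trans (Ef_ n) _; rewrite lee_fin le_max lexx orbT.
(* An ultrafilter gives limits of all bounded real sequences at once, linear in the functional and
   without a subsequence for each [phi]. *)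
have [U [UU Uoo]] := ultraFilterLemma (F := \oo) _.
have bnd phi (K : R) n : 0 <= K -> bounded_by mu E phi K -> `|phi (f_ n)| <= K * B.
  move=> K0 /(_ (f_ n)); have := Mf_ n => /MEP Mn /(_ Mn).
  rewrite normLeE// => h; rewrite -lee_fin; apply: le_trans h _.
  by rewrite EFinM lee_wpmul2l ?lee_fin.
have cvU phi : in_dual mu E phi -> cvg (phi (f_ n) @[n --> U]).
  move=> [_ [K [K0 bK]]].
  have := @segment_compact R (- (K * B)) (K * B); rewrite compact_ultra => /(_ (phi (f_ n) @[n --> U])).
  have mem : (phi (f_ n) @[n --> U]) [set` `[- (K * B), K * B]].
    apply: (@filterS _ U _ setT); last exact: filterT.
    by move=> n _ /=; rewrite in_itv /= -ler_norml; exact: bnd.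
  by move=> /(_ (fmap_ultra _ UU) mem)[l [_ cl]]; apply/cvg_ex; exists l.
pose Phi phi : R := lim (phi (f_ n) @[n --> U]).
have biPhi : in_bidual mu E Phi.
  split.
  - move=> a b phi psi dphi dpsi; apply: cvg_lim => //.
    by apply: cvgD; apply: cvgM; [exact: cvg_cst|exact: cvU|exact: cvg_cst|exact: cvU].
  - exists B; split; first by lra.
    move=> phi K dphi K0 bK; rewrite mulrC.
    have cn : `|phi (f_ n)| @[n --> U] --> `|Phi phi| by apply: cvg_norm; exact: cvU.
    apply: (cvgr_to_le cn); apply: (@filterS _ U _ setT); last exact: filterT.
    by move=> n _; exact: bnd.
(* [e / 8] is strictly below the separation [e / 4] obtained next; two distances [e / 4] then add up
   to [e / 2 < e]. *)
have e8 : 0 < e / 8 by lra.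
have [y [/MEP My Hy]] := refl Phi (e / 8) biPhi e8.
have key m : exists2 g, conv_hull f_ m g & q (fun x => g x - y x) < e / 4.
  apply: contrapT => /forall2NP no.
  have geq g : conv_hull f_ m g -> e / 4 <= q (fun x => g x - y x).
    by move=> hg; have [//|/negP] := no g; rewrite -leNgt.
  pose C k := exists2 g, conv_hull f_ m g & k = (fun x => g x - y x).
  have SB g : ME' g -> ME' (fun x => g x - y x).
    move=> Mg; have := ME'D Mg (ME'Z (-1) My).
    by under eq_fun do rewrite mulN1r.
  have [|||p [sp pq pC]] := @sublinear_cone R X ME' ME'0 ME'D ME'Z q C (e / 4)
      (fun x => f_ m x - y x) sublinear_q.
  - by exists (f_ m) => //; exact: conv_hull_pt.
  - move=> _ [g hg ->]; split; last exact: geq.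
    by apply: SB; exact: conv_hull_ME' hg.
  - move=> s t _ _ s0 t0 st0 [g hg ->] [g' hg' ->].
    exists (fun x => (s / (s + t) * g x + (1 - s / (s + t)) * g' x) - y x).
      exists (fun x => s / (s + t) * g x + (1 - s / (s + t)) * g' x) => //.
      apply: conv_hull_comb => //.
      by apply: ratio_itv01 => //; rewrite lerDl.
    by move=> x; field; rewrite gt_eqF.
  have [phi [phip lin]] := dominated_linear ME'0 ME'D ME'Z sp.
  have phiq g : ME' g -> phi g <= q g by move=> Mg; apply: le_trans (phip _ Mg) (pq _ Mg).
  have phiN g : ME' g -> phi (fun x => - g x) = - phi g.
    move=> Mg; have := lin (-1) 0 _ _ Mg Mg.
    have -> : (fun x => -1 * g x + 0 * g x) = (fun x => - g x) by apply/funext => x; ring.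
    by move=> ->; ring.
  have bphi : bounded_by mu E phi 1.
    move=> g /MEP Mg; rewrite mul1e normLeE; last exact: Mg.1.
    rewrite -(fineK (normLe_fin Mg.1.1 Mg.2)) lee_fin ler_norml phiq// andbT.
    have MN : ME' (fun x => - g x).
      by have := ME'Z (-1) Mg; under eq_fun do rewrite mulN1r.
    have := phiq _ MN; rewrite phiN//.
    have -> : q (fun x => - g x) = q g.
      rewrite /q /normLe /luxemburg; congr (fine (ereal_inf _)).
      have EN k : L0 k -> (Ee mu E (fun x => - k x)%R <= 1)%E -> (Ee mu E k <= 1)%E.
        move=> mk h; have := Ee_opp sf nE (L0N mk) h.
        by under eq_fun do rewrite opprK.
      have mg := Mg.1.1.
      apply/seteqP; split => _ [l [l0 h] <-]; exists l => //; split => //.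
        apply: EN; first exact: L0Z.
        by move: h; under eq_fun do rewrite mulrN.
      apply: EN; first by apply: L0Z; exact: L0N.
      by move: h; under [in X in _ -> X]eq_fun do rewrite mulrN opprK.
    by move=> h; rewrite lerNl; exact: h.
  have dphi : in_dual mu E phi.
    split; last by exists 1; split.
    by move=> a b g g' /MEP Mg /MEP Mg'; exact: lin.
  (* [pC] at [-(f_ k - y)] bounds [phi] there by [q 0 - e / 4], so [phi] separates the whole tail
     from [y]. *)
  have low k : (m <= k)%N -> e / 4 <= phi (f_ k) - phi y.
    move=> mk; have := SB _ (Mf_ k) => Mk.
    have MN : ME' (fun x => - (f_ k x - y x)).
      by have := ME'Z (-1) Mk; under eq_fun do rewrite mulN1r.
    have Ck : C (fun x => f_ k x - y x) by exists (f_ k) => //; exact: conv_hull_pt.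
    have := pC _ _ MN Ck.
    have -> : (fun x => - (f_ k x - y x) + (f_ k x - y x)) = (fun=> 0).
      by apply/funext => x; rewrite addNr.
    have [-> _ _] := sublinear_q.
    move=> h; have := le_trans (phip _ MN) h; rewrite phiN//.
    have := lin 1 (-1) _ _ (Mf_ k) My.
    have -> : (fun x => 1 * f_ k x + -1 * y x) = (fun x => f_ k x - y x) by apply/funext => x; ring.
    by move=> ->; lra.
  have := Hy phi 1 dphi ler01 bphi.
  have : e / 4 <= Phi phi - phi y.
    have cn : phi (f_ n) - phi y @[n --> U] --> Phi phi - phi y.
      by apply: cvgB; [exact: cvU|exact: cvg_cst].
    apply: (cvgr_to_ge cn); apply: Uoo; exists m => // n /= mn; exact: low.
  by move=> h1 h2; have := ler_norm (Phi phi - phi y); lra.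
have /choice[g Hg] : forall m, exists g, conv_hull f_ m g /\ q (fun x => g x - y x) < e / 4.
  by move=> m; have [g ? ?] := key m; exists g.
have Mg m : ME' (g m) by exact: conv_hull_ME' (Hg m).1.
have Mgy m : ME' (fun x => g m x - y x).
  have := ME'D (Mg m) (ME'Z (-1) My); by under eq_fun do rewrite mulN1r.
have my : L0 y := My.1.1.
have Efy : (Ee mu E (fun x => (e / 4)^-1 * (f x - y x))%R <= 1)%E.
  apply: (@Ee_lsc _ _ _ _ sf _ (fun m x => (e / 4)^-1 * (g m x - y x))).
  - by apply: L0Z; exact: L0B.
  - by move=> m; apply: L0Z; exact: (Mgy m).1.1.
  - by move=> N; exists N; split => //; apply: q_lt => //; exact: (Hg N).2.
  - apply: aeS cf => x cx; apply: cvgM; first exact: cvg_cst.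
    apply: cvgB; last exact: cvg_cst.
    exact: conv_hull_cvg (fun m => (Hg m).1) cx.
exists (g 0%N); first exact: (Hg 0%N).1.
apply: (@le_lt_trans _ _ (e / 2)%:E); last by rewrite lte_fin; lra.
apply: normLe_le; first by lra.
have Eyg : (Ee mu E (fun x => - ((e / 4)^-1 * (g 0%N x - y x)))%R <= 1)%E.
  apply: (Ee_opp sf nE); first by apply: L0Z; exact: (Mgy 0%N).1.1.
  by apply: q_lt => //; exact: (Hg 0%N).2.
have t01 : 0 <= (2^-1 : R) <= 1 by apply/andP; split; lra.
have := Ee_conv sf nE (L0Z _ (L0B mf my)) (L0N (L0Z _ (Mgy 0%N).1.1)) t01 Efy Eyg.
have -> : 2^-1 * 1 + (1 - 2^-1) * 1 = 1 :> R by ring.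
congr (Ee _ _ _ <= _)%E; apply/funext => x; field; by rewrite gt_eqF.
Qed.

End Mazur.

(** * Nests and capacities *)
Section Exceptional.
Context (R : realType) (X : ptopologicalType)
        (mu : {measure set (borel X) -> \bar R}) (E : (X -> R) -> \bar R).
Hypothesis (sf : sigma_finite [set: borel X] mu).
Hypothesis (nE : nopf mu E) (eE : Ee_exists mu E) (D2 : Delta2 mu E).
Implicit Types (f g h u v w p : X -> R) (A : set X).

Lemma cap_eq0P h A : cap mu E h A = 0%E <-> forall d : R, 0 < d ->
  exists p (U : set X), [/\ L0 p, open U, A `<=` U,
    {ae mu, forall x, U x -> h x <= p x} & (Ee mu E p <= d%:E)%E].
Proof.
split => [c0 d d0|H].
  have : (cap mu E h A < d%:E)%E by rewrite c0 lte_fin.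
  move=> /ereal_inf_lt[_ [p [mp [U [oU [AU pU]]]] <-] /ltW Ep].
  by exists p, U.
apply/eqP; rewrite eq_le; apply/andP; split; last first.
  by apply: le_ereal_inf_tmp => _ [p _ <-]; exact: (Ee_ge0 nE).
apply/lee_addgt0Pr => d d0; rewrite add0e.
have [p [U [mp oU AU pU Ep]]] := H d d0.
by apply: le_trans Ep; apply: ereal_inf_lbound; exists p => //; split => //; exists U.
Qed.

Lemma cap_eq0_of_exceptional h A : exceptional mu E A -> dom_Ee mu E h -> cap mu E h A = 0%E.
Proof.
move=> [F [[_ [_ dense]] AF]] /(MEeP sf nE eE D2) Mh; apply/cap_eq0P => d d0.
(* A norm below [d1] bounds by 1 the energy of the difference divided by [d1]; for [d1 <= 1]
   convexity at 0 brings the factor back. *)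
pose d1 := Num.min d 1.
have d10 : 0 < d1 by rewrite lt_min d0 ltr01.
have [n [g [[Mg [U [oU [FU gU]]]] hg]]] := dense h d1 Mh d10.
have mh := (MEeP sf nE eE D2 h).1 Mh; have mg := (MEeP sf nE eE D2 g).1 Mg.
exists (fun x => h x - g x), U; split => //.
- exact: L0B mh.1 mg.1.
- by move=> x Ax; apply: FU; exact: AF.
- by apply: aeS gU => x gx /gx ->; rewrite subr0.
- have h1 := normLe_lt sf nE eE (L0B mh.1 mg.1) hg.
  have d01 : 0 <= d1 <= 1 by rewrite ltW//= ge_min lexx orbT.
  have := Ee_scale sf nE eE (L0Z _ (L0B mh.1 mg.1)) d01 h1.
  under eq_fun do rewrite mulVKf ?gt_eqF//.
  move=> /le_trans; apply; by rewrite mulr1 lee_fin ge_min lexx.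
Qed.

(** Submodularity for [-f] and 0, with 0 as lower bound for the energy of their maximum; evenness
    turns the minimum into the positive part. *)
Lemma Ee_pos f (c : R) : L0 f -> (Ee mu E f <= c%:E)%E ->
  (Ee mu E (fun x => Num.max (f x) 0)%R <= c%:E)%E.
Proof.
move=> mf Ef.
have m0 : L0 (fun _ : X => 0 : R) by exact: L0cst.
have E0 : (Ee mu E (fun _ => 0)%R <= 0%:E)%E by rewrite (Ee0 nE eE).
have := Ee_submod sf nE eE (L0N mf) m0 (Ee_opp sf nE mf Ef) E0 (Ee_ge0 nE _).
rewrite addr0 subr0 => /(Ee_opp sf nE (L0min (L0N mf) m0)).
by congr (Ee _ _ _ <= _)%E; apply/funext => x; rewrite oppr_min opprK oppr0.
Qed.

Definition truncates (e : X -> R) := forall f (c : R), L0 f -> (Ee mu E f <= c%:E)%E ->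
  (Ee mu E (fun x => Num.min (f x) (e x)) <= c%:E)%E.

Definition clip (a e : R) : R := Num.max (Num.min a e) (- e).

(** Truncation from above, applied before and after a change of sign. *)
Lemma Ee_clip (e : X -> R) f (c : R) : L0 e -> truncates e -> L0 f ->
  (Ee mu E f <= c%:E)%E -> (Ee mu E (fun x => clip (f x) (e x)) <= c%:E)%E.
Proof.
move=> me te mf Ef; have mm := L0min mf me.
have := te _ _ (L0N mm) (Ee_opp sf nE mm (te _ _ mf Ef)).
move=> /(Ee_opp sf nE (L0min (L0N mm) me)).
by congr (Ee _ _ _ <= _)%E; apply/funext => x; rewrite /clip oppr_min opprK.
Qed.

Lemma norm_clip (a e : R) : 0 <= e -> `|clip a e| <= `|a| /\ `|clip a e| <= e.
Proof.
move=> e0; rewrite /clip; split; last first.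
  rewrite ler_norml le_max lexx orbT/= ge_max ge_min lexx orbT/=; lra.
have h1 := ler_norm a; have h2 := ler_norm (- a); rewrite normrN in h2.
have h3 := normr_ge0 a.
rewrite ler_norml le_max le_min ge_max ge_min; apply/andP; split.
  by apply/orP; left; apply/andP; split; lra.
by apply/andP; split; [apply/orP; left|lra].
Qed.

Lemma clip_id (a e : R) : `|a| <= e -> clip a e = a.
Proof. by rewrite ler_norml => /andP[h1 h2]; rewrite /clip min_l// max_l. Qed.

(** Soft thresholding: a difference of positive parts, hence controlled by the lattice and convexity
    properties of the energy. *)
Definition soft (a p : R) : R := Num.max (a - p) 0 - Num.max (- a - p) 0.

Lemma norm_soft (a p : R) : 0 <= p -> `|soft a p| <= `|a|.
Proof.
move=> p0; rewrite /soft.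
have h1 := ler_norm a; have h2 := ler_norm (- a); rewrite normrN in h2.
case: (leP (a - p) 0) => ha; case: (leP (- a - p) 0) => hb; rewrite ler_norml; lra.
Qed.

Lemma soft_eq0 (a p : R) : `|a| <= p -> soft a p = 0.
Proof.
by rewrite ler_norml => /andP[h1 h2]; rewrite /soft !max_r ?subrr//; lra.
Qed.

Lemma soft0 (a : R) : soft a 0 = a.
Proof. by rewrite /soft !subr0; case: (leP a 0) => h; case: leP => h2; lra. Qed.

Lemma L0soft f p : L0 f -> L0 p -> L0 (fun x => soft (f x) (p x)).
Proof.
move=> mf mp; have m0 : L0 (fun _ : X => 0 : R) by exact: L0cst.
by apply: L0B; apply: L0max => //; apply: L0B => //; exact: L0N.
Qed.

(** The difference [u - p] and the difference of the two positive parts each cost a factor 2 inside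
    the energy, hence the constant for multiplication by [2^2]. *)
Lemma Ee_soft : exists2 K : R, 0 <= K & forall f p (c : R), L0 f -> L0 p ->
  (Ee mu E f <= c%:E)%E -> (Ee mu E p <= 1)%E ->
  (Ee mu E (fun x => soft (f x) (p x)) <= (K * (c + 1))%:E)%E.
Proof.
have [K K1 HK] := Ee_Delta2X sf nE D2 2.
exists (K / 2); first by lra.
move=> f p c mf mp Ef Ep.
have m0 : L0 (fun _ : X => 0 : R) by exact: L0cst.
have t01 : 0 <= (2^-1 : R) <= 1 by apply/andP; split; lra.
have half u v (a : R) : L0 u -> L0 v -> (Ee mu E (fun x => 2 * u x)%R <= a%:E)%E ->
    (Ee mu E (fun x => 2 * v x)%R <= a%:E)%E -> (Ee mu E (fun x => u x - v x)%R <= a%:E)%E.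
  move=> m_u m_v Eu Ev.
  have := Ee_conv sf nE (L0Z 2 m_u) (L0N (L0Z 2 m_v)) t01 Eu (Ee_opp sf nE (L0Z 2 m_v) Ev).
  have -> : 2^-1 * a + (1 - 2^-1) * a = a by field.
  by congr (Ee _ _ _ <= _)%E; apply/funext => x; field.
have part u : L0 u -> (Ee mu E u <= c%:E)%E ->
    (Ee mu E (fun x => 2 * Num.max (u x - p x) 0)%R <= (K / 2 * (c + 1))%:E)%E.
  move=> m_u Eu.
  have := Ee_conv sf nE (L0Z (2 ^+ 2) m_u) (L0N (L0Z (2 ^+ 2) mp)) t01 (HK _ _ m_u Eu)
    (Ee_opp sf nE (L0Z (2 ^+ 2) mp) (HK _ _ mp Ep)).
  have -> : 2^-1 * (K * c) + (1 - 2^-1) * (K * 1) = K / 2 * (c + 1) by field.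
  have -> : (fun x => 2^-1 * (2 ^+ 2 * u x) + (1 - 2^-1) * - (2 ^+ 2 * p x)) =
            (fun x => 2 * (u x - p x)) by apply/funext => x; field.
  move=> /(Ee_pos (L0Z 2 (L0B m_u mp))).
  by congr (Ee _ _ _ <= _)%E; apply/funext => x; rewrite maxr_pMr// mulr0.
apply: half.
- by apply: L0max => //; exact: L0B.
- by apply: L0max => //; apply: L0B => //; exact: L0N.
- exact: part.
- by apply: part; [exact: L0N|exact: (Ee_opp sf nE)].
Qed.

Lemma normLe_triangle f g h (a : R) : L0 f -> L0 g -> L0 h -> 0 < a ->
  (normLe mu E (fun x => f x - g x)%R < a%:E)%E ->
  (normLe mu E (fun x => g x - h x)%R < a%:E)%E ->
  (normLe mu E (fun x => f x - h x)%R <= (2 * a)%:E)%E.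
Proof.
move=> mf mg mh a0 h1 h2; apply: normLe_le; first by lra.
have t01 : 0 <= (2^-1 : R) <= 1 by apply/andP; split; lra.
have := Ee_conv sf nE (L0Z _ (L0B mf mg)) (L0Z _ (L0B mg mh)) t01
  (normLe_lt sf nE eE (L0B mf mg) h1) (normLe_lt sf nE eE (L0B mg mh) h2).
have -> : 2^-1 * 1 + (1 - 2^-1) * 1 = 1 :> R by ring.
by congr (Ee _ _ _ <= _)%E; apply/funext => x; field; rewrite gt_eqF.
Qed.

(** Reflexivity is about the L2 modular space, nests are about that of [Ee]; the Mazur lemma for L2
    approximants of [f] links them. *)
Lemma L2_dense f (d : R) : reflexive_form mu E -> MEe mu E f -> 0 < d ->
  exists2 g, ME' mu E g & (normLe mu E (fun x => f x - g x)%R < d%:E)%E.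
Proof.
move=> refl /(MEeP sf nE eE D2)[mf Ef] d0.
have Efin : Ee mu E f \is a fin_num by rewrite ge0_fin_numE// (Ee_ge0 nE).
have Ef' : (Ee mu E f <= (fine (Ee mu E f))%:E)%E by rewrite fineK.
have [fn [Lfn Efn cf]] := Ee_approx sf mf Ef' ltr01.
have Een n : (Ee mu E (fn n) <= (fine (Ee mu E f) + 1)%:E)%E by rewrite eE.
have [g hg ng] := mazur sf nE eE D2 refl Lfn Een mf cf d0.
exists g => //; apply: (conv_hull_ME' sf nE eE D2 _ hg) => n; split => //.
by apply: le_lt_trans (Een n) (ltry _).
Qed.

Lemma exceptional_of_cap_eq0 (e : nat -> X -> R) A : reflexive_form mu E -> subcritical mu E ->
  (forall n, L0 (e n)) -> (forall n x, 0 <= e n x) -> (forall n, truncates (e n)) ->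
  {ae mu, forall x, forall M : R, \forall n \near \oo, M <= e n x} ->
  (forall n, cap mu E (e n) A = 0%E) -> exceptional mu E A.
Proof.
move=> refl sub me e0 te ediv capA.
have /choice[pU HpU] : forall n, exists pU : (X -> R) * set X,
    [/\ L0 pU.1, forall x, 0 <= pU.1 x, open pU.2, A `<=` pU.2 &
      [/\ {ae mu, forall x, pU.2 x -> e n x <= pU.1 x}, (Ee mu E pU.1 <= 1)%E &
       (Ee mu E (fun x => 2 ^+ n * pU.1 x)%R <= 1)%E]].
  (* Energy at most [K^-1] gives [2^n * p n] energy at most 1, as the convergence of [p n] to 0
     requires; [K >= 1] bounds the energy of [p n] itself. *)
  move=> n; have [K K1 HK] := Ee_Delta2X sf nE D2 n.
  have K0 : 0 < K by lra.
  have Ki : 0 < K^-1 by rewrite invr_gt0.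
  have [p [U [mp oU AU pU Ep]]] := (cap_eq0P _ _).1 (capA n) _ Ki.
  have mp' : L0 (fun x => Num.max (p x) 0) by apply: L0max => //; exact: L0cst.
  have Ep' := Ee_pos mp Ep.
  exists (fun x => Num.max (p x) 0, U); split => //=.
  - by move=> x; rewrite le_max lexx orbT.
  split.
  - by apply: aeS pU => x px /px h; rewrite le_max h.
  - by apply: le_trans Ep' _; rewrite lee_fin invf_le1.
  - by apply: le_trans (HK _ _ mp' Ep') _; rewrite lee_fin mulfV// gt_eqF.
pose p n := (pU n).1; pose U n := (pU n).2.
have mp n : L0 (p n) by have [] := HpU n.
have p0 n x : 0 <= p n x by have [_ h _ _ _] := HpU n; exact: h.
have oU n : open (U n) by have [] := HpU n.
have AU n : A `<=` U n by have [] := HpU n.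
have pU' n : {ae mu, forall x, U n x -> e n x <= p n x} by have [_ _ _ _ []] := HpU n.
have Ep n : (Ee mu E (p n) <= 1)%E by have [_ _ _ _ []] := HpU n.
have cp : {ae mu, forall x, p n x @[n --> \oo] --> (0 : R)}.
  by apply: (cvg0_of_Ee_bounded sf nE sub mp p0) => n; have [_ _ _ _ []] := HpU n.
pose V := fix V n := if n is n'.+1 then V n' `&` U n'.+1 else U 0%N.
have oV n : open (V n) by elim: n => [|n IH]; [exact: oU|exact: openI].
have AV n : A `<=` V n by elim: n => [|n IH]; [exact: AU|move=> x Ax; split; [exact: IH|exact: AU]].
have VU n : V n `<=` U n by case: n => [|n] x // [].
have Vmono n m : (n <= m)%N -> V m `<=` V n.
  elim: m => [|m IH]; first by rewrite leqn0 => /eqP ->.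
  by rewrite leq_eqVlt => /orP[/eqP ->//|/IH h] x [/h].
exists (fun n => ~` V n); split; last by move=> x Ax n _; rewrite setCK; exact: AV.
split; first by move=> n; apply: open_closedC.
split; first by move=> n; apply: subsetC; exact: Vmono.
move=> f eps Mf eps0; have d0 : 0 < eps / 4 by lra.
have [g1 M1 n1] := L2_dense refl Mf d0.
have [L1 E1] := M1; have m1 : L0 g1 := L1.1.
have mf : L0 f by have [] := (MEeP sf nE eE D2 f).1 Mf.
have Efin : Ee mu E g1 \is a fin_num by rewrite ge0_fin_numE// (Ee_ge0 nE).
have E1' : (Ee mu E g1 <= (fine (Ee mu E g1))%:E)%E by rewrite fineK.
pose w n x := clip (g1 x) (e n x).
pose z n x := soft (w n x) (p n x).
have mw n : L0 (w n).
  by apply: L0max; [exact: L0min|exact: L0N].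
have mz n : L0 (z n) by exact: L0soft.
have Lz n : L2 mu (z n).
  apply: (L2_dom (mz n) L1) => x; apply: le_trans (norm_soft _ (p0 n x)) _.
  exact: (norm_clip _ (e0 n x)).1.
have [K K0 HK] := Ee_soft.
have Ez n : (Ee mu E (z n) <= (K * (fine (Ee mu E g1) + 1))%:E)%E.
  by apply: HK => //; exact: Ee_clip.
(* Since [e n] diverges, clipping is eventually inactive at almost every point, and the threshold
   [p n] tends to 0. *)
have cz : {ae mu, forall x, z n x @[n --> \oo] --> g1 x}.
  apply: aeS2 cp ediv => x cpx dx.
  have cw : w n x @[n --> \oo] --> g1 x.
    by apply: cvg_near_cst; apply: filterS (dx `|g1 x|) => n h; exact: clip_id.
  rewrite -[g1 x in X in _ --> X]soft0 /z /soft.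
  by apply: cvgB; apply: cvgn_max; (try exact: cvg_cst); apply: cvgB => //; exact: cvgN.
have [g hg ng] := mazur sf nE eE D2 refl Lz Ez m1 cz d0.
have Mg : ME' mu E g.
  apply: (conv_hull_ME' sf nE eE D2 _ hg) => n; split => //.
  by apply: le_lt_trans (Ez n) (ltry _).
(* On [U k] one has [|w k| <= e k <= p k], so thresholding gives 0. A hull element involves finitely
   many [z k], and all of them vanish on the last [V n] used. *)
have [n gV] : exists n, {ae mu, forall x, V n x -> g x = 0}.
  apply: (conv_hull_closed_ind (P := fun g => exists n, {ae mu, forall x, V n x -> g x = 0}) _ _ hg).
    move=> k _; exists k; apply: aeS (pU' k) => x h /VU/h ep.
    apply: soft_eq0; apply: le_trans ep; exact: (norm_clip _ (e0 k x)).2.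
  move=> t h h' _ [n Hn] [n' Hn']; exists (maxn n n').
  apply: aeS2 Hn Hn' => x a b Vx.
  rewrite a ?b; first by rewrite !mulr0 addr0.
  - exact: Vmono (leq_maxr n n') _ Vx.
  - exact: Vmono (leq_maxl n n') _ Vx.
exists n, g; split.
  split; first by apply/(MEeP sf nE eE D2); split; [exact: Mg.1.1|exact: Mg.2].
  by exists (V n); rewrite setCK; split; [exact: oV|split].
apply: le_lt_trans (normLe_triangle mf m1 Mg.1.1 d0 n1 ng) _.
by rewrite lte_fin; lra.
Qed.

Lemma natr_mul_divergent (a : R) : 0 < a ->
  forall M : R, \forall n \near \oo, M <= n.+1%:R * a.
Proof.
move=> a0 M; exists (Num.truncn `|M / a|).+1 => // n /= h.
rewrite -ler_pdivrMr//; apply: le_trans (ler_norm _) _.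
apply: le_trans (ltW (truncnS_gt _)) _; rewrite ler_nat.
exact: leq_trans h (leqnSn n).
Qed.

Lemma Ee_scale_bound (t : nat) : exists2 K : R, 1 <= K & forall f (c : R), L0 f ->
  (Ee mu E f <= c%:E)%E -> (Ee mu E (fun x => t%:R * f x)%R <= (K * c)%:E)%E.
Proof.
have [K K1 HK] := Ee_Delta2X sf nE D2 t.
exists K => // f c mf Ef.
have p2 : 0 < 2 ^+ t :> R by rewrite exprn_gt0.
have t2 : t%:R <= 2 ^+ t :> R by rewrite -natrX ler_nat ltnW// ltn_expl.
have t01 : 0 <= (t%:R / 2 ^+ t : R) <= 1 by exact: ratio_itv01.
have := Ee_scale sf nE eE (L0Z _ mf) t01 (HK _ _ mf Ef).
under eq_fun do rewrite mulrA divfK ?gt_eqF//.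
move=> /le_trans; apply; rewrite lee_fin.
have c0 : 0 <= c by rewrite -lee_fin; apply: le_trans Ef; exact: (Ee_ge0 nE).
have Kc : 0 <= K * c by rewrite mulr_ge0// (le_trans ler01).
by rewrite ler_piMl//; case/andP: t01.
Qed.

End Exceptional.

Unset Implicit Arguments.

Theorem theorem5p7 (R : realType) (X : ptopologicalType)
    (mu : {measure set (borel X) -> \bar R})
    (E : (X -> R) -> \bar R) (h : X -> R) (A : set X) :
  hausdorff_space X ->
  sigma_finite [set: borel X] mu ->
  nopf mu E -> Ee_exists mu E ->
  reflexive_form mu E -> subcritical mu E -> Delta2 mu E ->
  excessive mu E h -> dom_Ee mu E h -> {ae mu, forall x, (0 < h x)%R} ->
  (exceptional mu E A <->
     (forall ht : X -> R, excessive mu E ht -> dom_Ee mu E ht ->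
        {ae mu, forall x, (0 < ht x)%R} -> cap mu E ht A = 0%E)) /\
  ((forall N : nat, excessive mu E (fun x => (N.+1)%:R * h x)) ->
     (exceptional mu E A <-> cap mu E h A = 0%E)).
Proof.
move=> _ sf nE eE refl sub D2 xh dh h0.
have [mh [hge0 _]] := xh; have [_ Eh] := dh.
have hfin : Ee mu E h \is a fin_num by rewrite ge0_fin_numE// (Ee_ge0 nE).
have Eh' : (Ee mu E h <= (fine (Ee mu E h))%:E)%E by rewrite fineK.
have fwd ht : exceptional mu E A -> dom_Ee mu E ht -> cap mu E ht A = 0%E.
  by move=> xA dht; exact: (cap_eq0_of_exceptional sf nE eE D2 xA dht).
have nh_dvg : {ae mu, forall x, forall M : R, \forall n \near \oo, M <= n.+1%:R * h x}.
  by apply: aeS h0 => x; exact: natr_mul_divergent.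
have nh_fin n : exists c : R, (Ee mu E (fun x => n.+1%:R * h x)%R <= c%:E)%E.
  have [K _ HK] := Ee_scale_bound sf nE eE D2 n.+1.
  by exists (K * fine (Ee mu E h)); exact: HK.
split.
- split => [xA ht _ dht _|H]; first exact: fwd.
  (* The factor starts at 1, so that each [e n] is positive almost everywhere and qualifies as
     [ht]. *)
  have /choice[e He] : forall n, exists e : X -> R, [/\ L0 e, (forall x, 0 <= e x),
      {ae mu, forall x, n.+1%:R * h x <= e x}, (Ee mu E e < +oo)%E & truncates mu E e].
    move=> n; have [c Ec] := nh_fin n.
    have nh0 : {ae mu, forall x, 0 <= n.+1%:R * h x}.
      by apply: aeW => x; rewrite mulr_ge0.
    have [e [me e0 he Ece te]] := obstacle_minimizer sf nE eE sub (L0Z n.+1%:R mh) nh0 Ec.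
    by exists e; split => //; apply: le_lt_trans Ece (ltry _).
  have me n : L0 (e n) by have [] := He n.
  have e0 n x : 0 <= e n x by have [_ e0 _ _ _] := He n; exact: e0.
  have he n : {ae mu, forall x, n.+1%:R * h x <= e n x} by have [] := He n.
  have te n : truncates mu E (e n) by have [] := He n.
  apply: (exceptional_of_cap_eq0 sf nE eE D2 refl sub me e0 te).
    apply: aeS2 nh_dvg (ae_foralln he) => x dx hx M.
    by apply: filterS (dx M) => n /le_trans; apply.
  move=> n; apply: H.
  - apply: (excessive_of_truncation nE) => // f c Lf Ef.
    have Lm := L2min_nneg Lf (me n) (e0 n).
    by rewrite -(eE _ Lm); apply: te; [exact: Lf.1|rewrite (eE _ Lf)].
  - by split => //; have [] := He n.
  - apply: aeS2 h0 (he n) => x hx; apply: lt_le_trans; by rewrite mulr_gt0.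
- move=> xN; split => [xA|capA]; first exact: fwd.
  apply: (@exceptional_of_cap_eq0 _ _ _ _ sf nE eE D2 (fun n x => n.+1%:R * h x)) => //.
  - by move=> n; exact: L0Z.
  - by move=> n x; rewrite mulr_ge0.
  - by move=> n f c mf Ef; exact: (excessive_truncation sf nE eE (xN n) mf Ef).
  (* Delta2 turns a competitor [p] for [h] of energy at most [d / K] into the competitor [n.+1 * p]
     for [n.+1 * h] of energy at most [d]. *)
  move=> n; apply/(cap_eq0P nE) => d d0.
  have [K K1 HK] := Ee_scale_bound sf nE eE D2 n.+1.
  have K0 : 0 < K by apply: lt_le_trans K1.
  have dK : 0 < d / K by rewrite divr_gt0.
  have [p [U [mp oU AU pU Ep]]] := (cap_eq0P nE _ _).1 capA _ dK.
  exists (fun x => n.+1%:R * p x), U; split => //.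
  + exact: L0Z.
  + by apply: aeS pU => x px Ux; rewrite ler_pM2l//; exact: px.
  + by have := HK _ _ mp Ep; rewrite mulrC divfK// gt_eqF.
Qed.
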